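(* Let $f$ be analytic in the open unit disk $D$ and let $\varepsilon\in(0,1)$. Then there is a constant $C(f,\varepsilon)>0$, depending only on $f$ and $\varepsilon$, such that for every $x\in(0,1)$, every integer $n\ge n_0(x)$, and every $z$ with $|z|\le(1-\varepsilon)x$, \[ |r_n(f;z)|\le C(f,\varepsilon)\,\frac{(1-\varepsilon/2)^{2n}\,x^{2n+1}}{(1-x)^{2n+2}}\cdot\frac{(n!)^2}{((2n)!)^2}. \]
   Context: For $n\ge1$ let $y_n(z)=\sum_{k=0}^{n}\frac{(n+k)!}{(n-k)!\,k!}\left(\frac{z}{2}\right)^k$ be the $n$-th Bessel polynomial and let $\alpha_{n1},\dots,\alpha_{nn}$ be its zeros (they are simple). Put $a_{nk}=1-\alpha_{nk}/2$ and $b_{nk}=1+\alpha_{nk}/2$ for $k=1,\dots,n$. For $f$ analytic where needed define $r_n(f;z)=zf'(z)-\sum_{k=1}^n\big(f(a_{nk}z)-f(b_{nk}z)\big)$. For $x\in(0,1)$ put $n_0(x)=\max\{14,\;x^2(1-x)^{-2}\}-1$. *)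

(* Defs.v *)
From Stdlib Require Import Reals Arith Factorial.
Open Scope R_scope.

Definition Cx : Type := (R * R)%type.
Definition Cre (z : Cx) : R := fst z.
Definition Cim (z : Cx) : R := snd z.
Definition RtoC (a : R) : Cx := (a, 0).
Definition C0 : Cx := (0, 0).
Definition C1 : Cx := (1, 0).
Definition Cadd (z w : Cx) : Cx := (fst z + fst w, snd z + snd w).
Definition Copp (z : Cx) : Cx := (- fst z, - snd z).
Definition Csub (z w : Cx) : Cx := Cadd z (Copp w).
Definition Cmul (z w : Cx) : Cx :=
  (fst z * fst w - snd z * snd w, fst z * snd w + snd z * fst w).
Fixpoint Cpow (z : Cx) (k : nat) : Cx :=
  match k with O => C1 | S k' => Cmul z (Cpow z k') end.
Definition Cnorm (z : Cx) : R := sqrt (fst z * fst z + snd z * snd z).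

Fixpoint Csum1 (F : nat -> Cx) (n : nat) : Cx :=
  match n with O => C0 | S n' => Cadd (Csum1 F n') (F (S n')) end.
Definition Csum0 (F : nat -> Cx) (n : nat) : Cx := Cadd (F O) (Csum1 F n).

Definition in_disk (z : Cx) : Prop := Cnorm z < 1.

Definition is_cderiv (f : Cx -> Cx) (z l : Cx) : Prop :=
  forall eps : R, 0 < eps -> exists delta : R, 0 < delta /\
    forall h : Cx, Cnorm h < delta ->
      Cnorm (Csub (Csub (f (Cadd z h)) (f z)) (Cmul l h)) <= eps * Cnorm h.

Definition bessel_coef (n k : nat) : R :=
  INR (fact (n + k)) / (INR (fact (n - k)) * INR (fact k)).
Definition bessel_y (n : nat) (z : Cx) : Cx :=
  Csum0 (fun k => Cmul (RtoC (bessel_coef n k)) (Cpow (Cmul (RtoC (/2)) z) k)) n.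

Definition bessel_a (alpha : Cx) : Cx := Csub C1 (Cmul (RtoC (/2)) alpha).
Definition bessel_b (alpha : Cx) : Cx := Cadd C1 (Cmul (RtoC (/2)) alpha).
Definition r_n (f f' : Cx -> Cx) (alpha : nat -> Cx) (n : nat) (z : Cx) : Cx :=
  Csub (Cmul z (f' z))
    (Csum1 (fun k => Csub (f (Cmul (bessel_a (alpha k)) z))
                          (f (Cmul (bessel_b (alpha k)) z))) n).

Definition n0 (x : R) : R := Rmax 14 (x ^ 2 / (1 - x) ^ 2) - 1.

(* Main.v *)
(** Put [beta k = alpha k / 2]. A Cauchy integral over [|c| = r], with
    [r = (1 - eps) / (1 - eps / 2)], represents [r_n f] by the kernel obtained by applying
    [r_n] to [1 / (c - z)], which with [t = z / (c - z)] is
    [t / (c - z) * (1 + sum_k 2 beta k / (1 - (beta k)^2 t^2))]. The bracket is the Wronskian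
    of [exp (- t / 2) * t^n * y_n (2 / t)] and its reflection in [t], divided by a product,
    and the Bessel equation makes that Wronskian a multiple of [t^(2n)]; hence the bracket equals
    [(-1)^n (n! / (2n)!)^2 t^(2n) / prod_k (1 - (beta k)^2 t^2)].

    The product is bounded below by [(1 - 1/(n+1))^n >= 1/3], because
    [|beta k| <= 1 / (n + 1)] and [|t|^2 <= (x / (1 - x))^2 <= n + 1]. The bound on the zeros
    is read off the differential equation at a zero of maximal modulus.

    The derivative [f'] is not assumed continuous, so Cauchy's formula rests on Goursat's
    bisection argument, carried out in the parameter rectangle of the homotopy
    [w + l (r exp(i s) - w)] that contracts the circle to the point [w]. *)

Require Import Defs.
From Stdlib Require Import Reals Arith Factorial Lra Lia.
From Coquelicot Require Import Coquelicot.
From HB Require structures.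
From mathcomp Require all_boot all_order all_algebra ring.
From mathcomp Require boolp.
Open Scope R_scope.

(** * Zeros of Bessel polynomials *)

(** The ratio of the coefficients of index [k + 1] and [k] is (n + k + 1)(n - k) / (k + 1). It is
    indexed by [i = n - k - 1], the order in which the reversed polynomial t^n y_n(2 / t) takes the
    coefficients. *)
Lemma bessel_coef_rec (n i : nat) : (i < n)%nat ->
  bessel_coef n (n - S i) * (INR (S i) * (INR (2 * n) - INR i))
  = (INR n - INR i) * bessel_coef n (n - i).
Proof.
intro Hi; set (k := (n - S i)%nat); unfold bessel_coef.
replace (n - i)%nat with (S k) by (unfold k; lia).
replace (n - k)%nat with (S i) by (unfold k; lia).
replace (n - S k)%nat with i by (unfold k; lia).
replace (n + S k)%nat with (S (n + k)) by lia.
replace (INR n - INR i) with (INR (S k)) by (rewrite <- minus_INR by lia; f_equal; unfold k; lia).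
replace (INR (2 * n) - INR i) with (INR (S (n + k)))
  by (rewrite <- minus_INR by lia; f_equal; unfold k; lia).
rewrite !fact_simpl, !mult_INR.
field; repeat split; try apply INR_fact_neq_0; apply not_0_INR; lia.
Qed.

Lemma bessel_coef_top (n : nat) :
  bessel_coef n n = INR (fact (2 * n)) / INR (fact n).
Proof.
unfold bessel_coef; rewrite Nat.sub_diag; replace (n + n)%nat with (2 * n)%nat by lia.
simpl (fact 0); simpl (INR 1); field; apply INR_fact_neq_0.
Qed.

Lemma bessel_coef_bottom (n : nat) : bessel_coef n 0 = 1.
Proof.
unfold bessel_coef; rewrite Nat.sub_0_r, Nat.add_0_r.
simpl (fact 0); simpl (INR 1); field; apply INR_fact_neq_0.
Qed.

Module BesselAlgebra.
Import HB.structures.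
Import all_boot all_order all_algebra.
Import ring.
Set Implicit Arguments. Unset Strict Implicit. Unset Printing Implicit Defensive.
Import GRing.Theory.
Local Open Scope ring_scope.

Lemma horner_deriv_prod_XsubC (F : fieldType) (s : seq F) (t : F) : t \notin s ->
  (\prod_(g <- s) ('X - g%:P))^`().[t]
  = (\prod_(g <- s) ('X - g%:P)).[t] * \sum_(g <- s) (t - g)^-1.
Proof.
elim: s => [|g s IH]; first by rewrite !big_nil derivC !hornerE.
rewrite inE negb_or => /andP[tg ts]; rewrite !big_cons derivM derivXsubC.
rewrite !hornerE IH //.
have tg0 : t - g != 0 by rewrite subr_eq0.
by field.
Qed.

(** * The Bessel equation and its Wronskian over a field of characteristic 0 *)

Section bessel_ode.
Variables (F : fieldType) (n : nat) (e : nat -> F).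
Hypothesis charF : forall k, (k%:R == 0 :> F) = (k == 0)%N.
Hypothesis e_rec : forall i, (i < n)%N ->
  e i.+1 * (i.+1%:R * ((2 * n)%:R - i%:R)) = (n%:R - i%:R) * e i.
Hypothesis e_n : e n = 1.

(* With [e i = bessel_coef n (n - i)], [T.[t]] is [t ^+ n * y_n (2 / t)]; its roots
   are the numbers [2 / alpha]. *)
Let T : {poly F} := \poly_(i < n.+1) e i.

(** Comparing the coefficients of X^i turns the equation into [e_rec]. Under z = 2 / t it is the
    differential equation of y_n. *)
Lemma bessel_ode : 'X * T^`()^`() = ((2 * n)%:R + 'X) * T^`() - n%:R * T.
Proof.
have coefN (k : nat) (p : {poly F}) i : (k%:R * p)`_i = k%:R * p`_i.
  by rewrite -polyC_natr coefCM.
(* The recurrence at every index: for [i = n] the factor [n - i] and the next coefficient vanish,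
   and beyond [n] all coefficients are 0. *)
have TE i : T`_i.+1 * (i.+1%:R * ((2 * n)%:R - i%:R)) = (n%:R - i%:R) * T`_i.
  rewrite !coef_poly !ltnS; case: (ltngtP i n) => [lt|gt|->].
  - by rewrite e_rec.
  - by rewrite mul0r mulr0.
  - by rewrite subrr !mul0r.
apply/polyP => i; rewrite mulrDl coefB coefD !coefN !coefXM !coef_deriv.
case: i => [|i] /=.
  by have := TE 0%N; rewrite !mulr1n subr0 mul1r addr0 [_ * T`_1]mulrC => ->; rewrite subr0 subrr.
have := TE i.+1; move: (T`_i.+2) (T`_i.+1) => a b E.
apply/eqP; rewrite -subr_eq0; apply/eqP.
transitivity (- (a * (i.+2%:R * ((2 * n)%:R - i.+1%:R)) - (n%:R - i.+1%:R) * b)).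
  by ring.
by rewrite E subrr oppr0.
Qed.

(* [exp (- t / 2) * T(t)] and [exp (t / 2) * T(- t)] solve the same second-order equation;
   [W] is their Wronskian, and [t W' = 2 n W]. *)
Lemma bessel_wronskian (W := T^`() * (T \Po - 'X) + T * (T^`() \Po - 'X) - T * (T \Po - 'X)) :
  W = - (-1) ^+ n *: 'X^(2 * n).
Proof.
have ode2 := congr1 (fun p => p \Po - 'X) bessel_ode.
rewrite /= comp_polyM comp_polyB !comp_polyM comp_polyD comp_polyX -!polyC_natr !comp_polyC in ode2.
have ode1 := bessel_ode; rewrite -!polyC_natr in ode1.
have HW : 'X * W^`() = (2 * n)%:R%:P * W.
  rewrite /W !derivE !deriv_comp derivN derivX.
  move: ode1 ode2; set T1 := T^`(); set T2 := T1^`(); set a := (2 * n)%:R%:P.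
  set b := n%:R%:P => ode1 ode2.
  transitivity ('X * T2 * (T \Po - 'X) + T * (- 'X * (T2 \Po - 'X))
     - 'X * T1 * (T \Po - 'X) + 'X * T * (T1 \Po - 'X)); first by ring.
  rewrite ode1 ode2; have -> : a = b + b by rewrite /a /b -polyCD -natrD addnn mul2n.
  by ring.
(* Coefficientwise, t W' = 2 n W says (i - 2 n) W_i = 0, so in characteristic 0 only the term of
   degree 2 n survives. *)
have W0 i : i != (2 * n)%N -> W`_i = 0.
  move=> ni; have : (('X * W^`()) - (2 * n)%:R%:P * W)`_i = 0 by rewrite HW subrr coef0.
  rewrite coefB coefXM coefCM; case: i ni => [|i] ni /=.
    move/eqP; rewrite sub0r oppr_eq0 mulf_eq0 charF eq_sym (negbTE ni) /=.
    by move/eqP.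
  rewrite coef_deriv -[_ *+ i.+1]mulr_natl -mulrBl => /eqP; rewrite mulf_eq0 => /orP[|/eqP//].
  rewrite subr_eq0 => /eqP E; exfalso; move/negP: ni; apply.
  (* [charF] speaks of natural numbers, so the subtraction is taken in the order that does not
     truncate. *)
  have [le|/ltnW le] := leqP i.+1 (2 * n).
    by rewrite eqn_leq le -subn_eq0 -charF natrB // E subrr eqxx.
  by rewrite eqn_leq le andbT -subn_eq0 -charF natrB // E subrr eqxx.
have sT : size T = n.+1 by rewrite size_poly_eq // e_n oner_neq0.
have lT : lead_coef T = 1 by rewrite /lead_coef sT /T coef_poly ltnSn.
have sX : size (- 'X : {poly F}) = 2 by rewrite size_polyN size_polyX.
have sc (p : {poly F}) : (size (p \Po - 'X)) = size p.
  have [->|p0] := eqVneq p 0; first by rewrite comp_poly0.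
  have := size_comp_poly p (- 'X); rewrite sX muln1 => E.
  rewrite -(@prednK (size p)) ?size_poly_gt0 // -E prednK //.
  by rewrite size_poly_gt0 comp_poly2_eq0 // sX.
have sT1 : (size T^`() <= n)%N.
  by have := lt_size_deriv (_ : T != 0); rewrite sT ltnS; apply; rewrite -size_poly_gt0 sT.
(* The products containing a derivative have degree below 2 n, so the top coefficient is that of
   -T(t) T(-t), where T is monic. *)
have WN : W`_(2 * n) = - (-1) ^+ n.
  rewrite /W coefB coefD.
  have -> : (T^`() * (T \Po - 'X))`_(2 * n) = 0.
    apply: nth_default; apply: leq_trans (size_polyMleq _ _) _.
    by rewrite sc sT addnS /= mul2n -addnn leq_add2r.
  have -> : (T * (T^`() \Po - 'X))`_(2 * n) = 0.
    apply: nth_default; apply: leq_trans (size_polyMleq _ _) _.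
    by rewrite sc sT addSn /= mul2n -addnn leq_add2l.
  rewrite !add0r; congr (- _).
  have := lead_coefM T (T \Po - 'X).
  rewrite lead_coef_comp ?sX // lT sT /= lead_coefN lead_coefX !mul1r => <-.
  rewrite /lead_coef size_mul -?size_poly_gt0 ?sc sT //.
  by rewrite addSn addnS /= addnn mul2n.
apply/polyP => i; rewrite coefZ coefXn; case: eqP => [->|/eqP ni].
  by rewrite WN mulr1.
by rewrite W0 // mulr0.
Qed.

Variable s : seq F.
Hypothesis s_uniq : uniq s.
Hypothesis s_size : size s = n.
Hypothesis s_root : all (root T) s.

(** [T] is monic of degree [n] and [s] lists [n] distinct roots of it, hence all of them. *)
Lemma bessel_factor : T = \prod_(g <- s) ('X - g%:P).
Proof.
have sT : size T = n.+1 by rewrite size_poly_eq // e_n oner_neq0.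
have lT : lead_coef T = 1 by rewrite /lead_coef sT /T coef_poly ltnSn.
rewrite [LHS](all_roots_prod_XsubC _ s_root) ?uniq_rootsE ?sT ?s_size //.
by rewrite lT scale1r.
Qed.

(** Write T = (X - g) Q. At [g] one has T = 0, T' = Q and T'' = 2 Q', so the differential equation
    reduces to 2 g Q'(g) / Q(g) = 2 n + g. *)
Lemma bessel_root_sum g : g \in s ->
  \sum_(h <- rem g s) (2 * g) / (g - h) = (2 * n)%:R + g.
Proof.
move=> gs; pose Q := \prod_(h <- rem g s) ('X - h%:P).
have TQ : T = ('X - g%:P) * Q.
  by rewrite bessel_factor (perm_big _ (perm_to_rem gs)) big_cons.
have gr : g \notin rem g s by rewrite mem_rem_uniqF.
have Qg : Q.[g] != 0 by rewrite -[_ == 0]/(root Q g) root_prod_XsubC.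
have T1 : T^`() = Q + ('X - g%:P) * Q^`() by rewrite TQ derivM derivXsubC mul1r.
have T2 : T^`()^`() = Q^`() + (Q^`() + ('X - g%:P) * Q^`()^`()).
  by rewrite T1 derivD derivM derivXsubC mul1r.
have := congr1 (horner^~ g) bessel_ode.
rewrite T2 T1 TQ -!polyC_natr !hornerE subrr !mul0r !addr0 ?mulr0 ?subr0.
rewrite horner_deriv_prod_XsubC // -/Q => /= E.
apply: (mulIf Qg).
transitivity (g * (Q.[g] * \sum_(h <- rem g s) (g - h)^-1
  + Q.[g] * \sum_(h <- rem g s) (g - h)^-1)).
  by rewrite -mulr_sumr; ring.
by move: E; rewrite addr0 mulr0 mul0r subr0 => ->.
Qed.

(** The Wronskian identity divided by T(t) T(-t): each T' / T becomes a sum over the roots, and the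
    factors pair up as (t - g)(-t - g) = g^2 - t^2. *)
Lemma bessel_root_log_deriv t : t \notin s -> - t \notin s ->
  1 - \sum_(g <- s) ((t - g)^-1 + (- t - g)^-1)
  = (-1) ^+ n * t ^+ (2 * n) / \prod_(g <- s) (g ^+ 2 - t ^+ 2).
Proof.
move=> ts nts.
have := congr1 (horner^~ t) bessel_wronskian.
rewrite !hornerE !horner_comp !hornerE bessel_factor !horner_deriv_prod_XsubC //.
set S1 := \sum_(g <- s) _; set S2 := \sum_(g <- s) _.
have P0 (x : F) : x \notin s -> (\prod_(g <- s) ('X - g%:P)).[x] != 0.
  by move=> xs; rewrite -[_ == 0]/(root _ x) root_prod_XsubC.
have PP : \prod_(g <- s) (g ^+ 2 - t ^+ 2)
  = (\prod_(g <- s) ('X - g%:P)).[t] * (\prod_(g <- s) ('X - g%:P)).[- t].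
  rewrite !horner_prod -big_split /=; apply: eq_bigr => g _; rewrite !hornerE; ring.
rewrite big_split /= -/S1 -/S2 PP.
move: (P0 _ ts) (P0 _ nts); set p := horner _ t; set q := horner _ (- t) => p0 q0 E.
apply: (mulIf (mulf_neq0 p0 q0)); rewrite divfK ?mulf_neq0 //.
transitivity (- (p * S1 * q + p * (q * S2) - p * q)); first by ring.
by rewrite E; ring.
Qed.

(** Both sides are T(0)^2; the signs of the factors -g disappear in the square. *)
Lemma bessel_root_prod : \prod_(g <- s) (g ^+ 2) = e 0 ^+ 2.
Proof.
have -> : e 0 = T.[0] by rewrite horner_coef0 coef_poly.
rewrite bessel_factor horner_prod -prodrXl; apply: eq_bigr => g _.
by rewrite !hornerE; ring.
Qed.
End bessel_ode.

(* A new name, because [C] unfolds to a product type, on which MathComp puts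
   componentwise operations. *)
Definition CF : Type := C.
Lemma CF_addA : associative (Cplus : CF -> CF -> CF). Proof. exact: Cplus_assoc. Qed.
Lemma CF_addC : commutative (Cplus : CF -> CF -> CF). Proof. exact: Cplus_comm. Qed.
Lemma CF_add0 : left_id (RtoC 0 : CF) (Cplus : CF -> CF -> CF). Proof. exact: Cplus_0_l. Qed.
Lemma CF_addN : left_inverse (RtoC 0 : CF) (Copp : CF -> CF) Cplus.
Proof. by move=> x; rewrite Cplus_comm; exact: Cplus_opp_r. Qed.
Lemma CF_mulA : associative (Cmult : CF -> CF -> CF). Proof. exact: Cmult_assoc. Qed.
Lemma CF_mulC : commutative (Cmult : CF -> CF -> CF). Proof. exact: Cmult_comm. Qed.
Lemma CF_mul1 : left_id (RtoC 1 : CF) (Cmult : CF -> CF -> CF). Proof. exact: Cmult_1_l. Qed.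
Lemma CF_mulDl : left_distributive (Cmult : CF -> CF -> CF) Cplus.
Proof. exact: Cmult_plus_distr_r. Qed.

(** Decidable equality and choice on [CF] are obtained classically. *)
HB.instance Definition _ := boolp.gen_eqMixin CF.
HB.instance Definition _ := boolp.gen_choiceMixin CF.
HB.instance Definition _ := GRing.isZmodule.Build CF CF_addA CF_addC CF_add0 CF_addN.

Lemma CF_one_neq0 : (RtoC 1 : CF) != 0.
Proof. by apply/eqP => /(congr1 fst) /= E; apply: R1_neq_R0. Qed.

HB.instance Definition _ :=
  GRing.Zmodule_isComNzRing.Build CF CF_mulA CF_mulC CF_mul1 CF_mulDl CF_one_neq0.

Lemma CF_mulV (x : CF) : x != 0 -> Cmult (Cinv x) x = RtoC 1.
Proof. by move/eqP => x0; apply: Cinv_l. Qed.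
(** The field structure fixes 0^-1 = 0. Both coordinates of [Cinv] at 0 are quotients with numerator
    0, whatever the value of 1 / 0. *)
Lemma CF_inv0 : Cinv (RtoC 0 : CF) = RtoC 0.
Proof. by rewrite /Cinv /=; congr pair; rewrite ?Ropp_0 /Rdiv Rmult_0_l. Qed.

HB.instance Definition _ := GRing.ComNzRing_isField.Build CF CF_mulV CF_inv0.

Lemma CF_natr (n : nat) : (n%:R : CF) = RtoC (INR n).
Proof. by elim: n => // n IH; rewrite -addn1 natrD IH addn1 S_INR RtoC_plus. Qed.

Lemma CF_two : RtoC 2 = 2%:R :> CF.
Proof. by rewrite CF_natr. Qed.

Lemma CF_char k : ((k%:R : CF) == 0) = (k == 0)%N.
Proof.
rewrite CF_natr; apply/eqP/eqP => [/(congr1 fst) /= E|-> //].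
exact: INR_eq.
Qed.

Lemma Csum1_bigop (F : nat -> CF) n : Csum1 F n = \sum_(k <- iota 1 n) F k.
Proof.
elim: n => [|n IH]; first by rewrite big_nil.
rewrite -addn1 iotaD big_cat big_seq1 /= add1n addn1 -IH //.
Qed.

Fixpoint Cprod1 (F : nat -> C) (n : nat) : C :=
  match n with O => RtoC 1 | S m => Cmult (Cprod1 F m) (F (S m)) end.

Lemma Cprod1_bigop (F : nat -> CF) n : Cprod1 F n = \prod_(k <- iota 1 n) F k.
Proof.
elim: n => [|n IH]; first by rewrite big_nil.
rewrite -addn1 iotaD big_cat big_seq1 /= add1n addn1 -IH //.
Qed.

Lemma Cpow_exp (x : CF) k : Cpow x k = x ^+ k.
Proof. by elim: k => // k IH; rewrite exprS -IH. Qed.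


(** * The root identities in terms of the halved zeros of y_n *)

Section zeros.
Variables (n : nat) (beta : nat -> CF).
Hypothesis beta_root : forall k, (1 <= k <= n)%N ->
  Csum0 (fun i => Cmult (RtoC (bessel_coef n i)) (Cpow (beta k) i)) n = RtoC 0.
Hypothesis beta_inj : forall j k, (1 <= j <= n)%N -> (1 <= k <= n)%N ->
  j <> k -> beta j <> beta k.

Let e (i : nat) : CF := RtoC (bessel_coef n (n - i)%N).

Let e_rec i : (i < n)%N -> e i.+1 * (i.+1%:R * ((2 * n)%:R - i%:R)) = (n%:R - i%:R) * e i.
Proof.
move=> lt; rewrite !CF_natr /e -![_ - _]/(Cminus _ _) -!RtoC_minus.
rewrite -[LHS]/(Cmult _ (Cmult _ _)) -[RHS]/(Cmult _ _) -!RtoC_mult.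
by congr RtoC; apply: bessel_coef_rec; apply/ltP.
Qed.

Let e_n : e n = 1.
Proof. by rewrite /e subnn bessel_coef_bottom. Qed.

(** The constant coefficient is 1, so 0 is not a zero; this permits passing to reciprocals. *)
Lemma zero_neq0 k : (1 <= k <= n)%N -> beta k != 0.
Proof.
move=> kn; apply/eqP => E; have := beta_root kn; rewrite /Csum0 Csum1_bigop.
rewrite big1_seq => [|i /andP[_]]; last first.
  rewrite mem_iota => /andP[i0 _]; rewrite E Cpow_exp expr0n gtn_eqF //.
  exact: mulr0.
move/(congr1 fst); rewrite bessel_coef_bottom /= => E'; apply: R1_neq_R0.
by rewrite -E'; ring_simplify.
Qed.

Let T : {poly CF} := \poly_(i < n.+1) e i.
Let s := [seq (beta k)^-1 | k <- iota 1 n].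

Lemma mem_zeros k : (k \in iota 1 n) = (1 <= k <= n)%N.
Proof. by rewrite mem_iota add1n ltnS. Qed.

Let s_root : all (root T) s.
Proof.
apply/allP => _ /mapP[k kn ->]; rewrite mem_zeros in kn.
have b0 := zero_neq0 kn; apply/rootP; rewrite horner_poly.
(* Multiplying T(1 / beta_k) by beta_k^n reverses the order of the coefficients and gives the sum
   that vanishes in [beta_root]. *)
apply: (mulfI (expf_neq0 n b0)); rewrite mulr0 -[RHS](beta_root kn).
rewrite /Csum0 Csum1_bigop.
transitivity (\sum_(i <- iota 0 n.+1) (RtoC (bessel_coef n i) : CF) * beta k ^+ i); last first.
  rewrite /= big_cons; congr (_ + _).
  by apply: eq_bigr => i _; rewrite -Cpow_exp.
rewrite -[iota 0 n.+1]/(iota 0 (n.+1 - 0)) -/(index_iota 0 n.+1) big_mkord.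
rewrite [RHS](reindex_inj rev_ord_inj) mulr_sumr; apply: eq_bigr => i _ /=.
rewrite subSS /e mulrCA; congr (_ * _).
have le : (i <= n)%N by rewrite -ltnS.
by rewrite -{1}(subnK le) exprD -mulrA -exprMn mulfV // expr1n mulr1.
Qed.

Let s_uniq : uniq s.
Proof.
rewrite map_inj_in_uniq ?iota_uniq // => j k; rewrite !mem_zeros => jn kn /invr_inj E.
by apply: contra_eq E => /eqP jk; apply/eqP; apply: beta_inj.
Qed.

Let s_size : size s = n. Proof. by rewrite size_map size_iota. Qed.

(* The summand [j = k] is 0, because [x / 0 = 0]. *)
Lemma zero_sum k : (1 <= k <= n)%N ->
  Csum1 (fun j => Cdiv (Cmult (RtoC 2) (beta j)) (Cminus (beta j) (beta k))) n
  = Cplus (RtoC (INR (2 * n))) (Cinv (beta k)).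
Proof.
move=> kn; have b0 := zero_neq0 kn.
have ks : (beta k)^-1 \in s by apply: map_f; rewrite mem_zeros.
transitivity ((2 * n)%:R + (beta k)^-1 : CF); last by rewrite CF_natr.
rewrite -(bessel_root_sum e_rec e_n s_uniq s_size s_root ks).
rewrite Csum1_bigop.
transitivity (\sum_(h <- s) (2 * (beta k)^-1) / ((beta k)^-1 - h)); last first.
  by rewrite (big_rem _ ks) /= subrr invr0 mulr0 add0r.
rewrite big_map !big_seq; apply: eq_bigr => j; rewrite mem_zeros => jn.
have bj := zero_neq0 jn.
rewrite -[Cdiv _ _]/((RtoC 2 : CF) * beta j / (beta j - beta k)) CF_two.
have [E|jk] := eqVneq (beta j) (beta k); first by rewrite E !subrr invr0 !mulr0.
have d1 : beta j - beta k != 0 by rewrite subr_eq0.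
(* For g = 1 / beta_k and h = 1 / beta_j this gives 2 g / (g - h) = 2 beta_j / (beta_j - beta_k). *)
have -> : (beta k)^-1 - (beta j)^-1 = (beta j - beta k) / (beta j * beta k).
  by field; rewrite bj b0.
rewrite invf_div; match goal with |- ?a = ?b => change (a = b :> CF) end.
by field; rewrite d1 b0.
Qed.

(** This is [bessel_root_log_deriv] for the roots g = 1 / beta_k: the two terms of a root add up to
    -2 beta_k / (1 - beta_k^2 t^2), and the product of the g^2 is the square of the leading
    coefficient [bessel_coef n n]. *)
Lemma kernel (t : CF) :
  (forall k, (1 <= k <= n)%N ->
    Cminus (RtoC 1) (Cmult (Cmult (beta k) (beta k)) (Cmult t t)) <> RtoC 0) ->
  Cplus (RtoC 1) (Csum1 (fun k => Cdiv (Cmult (RtoC 2) (beta k))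
     (Cminus (RtoC 1) (Cmult (Cmult (beta k) (beta k)) (Cmult t t)))) n)
  = Cdiv (Cmult (Cpow (Copp (RtoC 1)) n) (Cpow t (2 * n)))
      (Cmult (Cpow (RtoC (bessel_coef n n)) 2)
        (Cprod1 (fun k => Cminus (RtoC 1) (Cmult (Cmult (beta k) (beta k)) (Cmult t t))) n)).
Proof.
move=> ht0; pose d k := 1 - (beta k * beta k) * (t * t) : CF.
have d0 k : (1 <= k <= n)%N -> d k != 0 by move=> kn; apply/eqP/ht0.
(* If [t] or [- t] were some 1 / beta_k, the factor 1 - beta_k^2 t^2 would vanish. Both signs are
   covered by [u * u = t * t]. *)
have nts (u : CF) : u * u = t * t -> u \notin s.
  move=> ut; apply/negP => /mapP[k kn E]; rewrite mem_zeros in kn.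
  move/eqP: (d0 _ kn); apply; rewrite /d -ut E; field.
  exact: zero_neq0.
have := bessel_root_log_deriv CF_char e_rec e_n s_uniq s_size s_root (nts t erefl)
  (nts (- t) (mulrNN t t)).
rewrite Csum1_bigop Cprod1_bigop !Cpow_exp big_map.
have -> : \prod_(g <- s) (g ^+ 2 - t ^+ 2)
  = (RtoC (bessel_coef n n) : CF) ^+ 2 * \prod_(k <- iota 1 n) d k.
  have := bessel_root_prod e_n s_uniq s_size s_root; rewrite /e subn0 => <-.
  rewrite !big_map -big_split /= !big_seq; apply: eq_bigr => k; rewrite mem_zeros => kn.
  by rewrite /d; field; apply: zero_neq0.
move=> E; transitivity ((-1) ^+ n * t ^+ (2 * n)
  / ((RtoC (bessel_coef n n) : CF) ^+ 2 * \prod_(k <- iota 1 n) d k)); last by [].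
rewrite -{}E -sumrN; congr (Cplus _ _); rewrite !big_seq; apply: eq_bigr => k.
rewrite mem_zeros => kn.
have b0 := zero_neq0 kn.
have dE : d k = (1 - beta k * t) * (1 + beta k * t) by rewrite /d; ring.
have := d0 _ kn; rewrite dE mulf_eq0 negb_or => /andP[H1 H2].
rewrite -[LHS]/((RtoC 2 : CF) * beta k / d k) CF_two.
have -> : t - (beta k)^-1 = - (1 - beta k * t) / beta k by field.
have -> : - t - (beta k)^-1 = - (1 + beta k * t) / beta k by field.
rewrite dE; match goal with |- ?a = ?b => change (a = b :> CF) end.
by field; rewrite !oppr_eq0 b0 H1 H2.
Qed.
End zeros.

Lemma index_rangeP k n : reflect (le 1 k /\ le k n) (1 <= k <= n)%N.
Proof. by apply: (iffP andP) => -[h1 h2]; split; apply/leP. Qed.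
End BesselAlgebra.

(** * Cauchy's integral formula *)

Lemma nested_intervals_point (a b : nat -> R) :
  (forall n, a n <= a (S n)) -> (forall n, b (S n) <= b n) ->
  (forall n, a n <= b n) -> exists p, forall n, a n <= p <= b n.
Proof.
intros Ha Hb Hab.
assert (Ga : forall n k, a n <= a (n + k)%nat).
{ intros n k; induction k as [|k IH].
  - rewrite Nat.add_0_r; lra.
  - rewrite Nat.add_succ_r; generalize (Ha (n + k)%nat); lra. }
assert (Gb : forall n k, b (n + k)%nat <= b n).
{ intros n k; induction k as [|k IH].
  - rewrite Nat.add_0_r; lra.
  - rewrite Nat.add_succ_r; generalize (Hb (n + k)%nat); lra. }
assert (Gab : forall n m, a n <= b m).
{ intros n m; generalize (Ga n m) (Gb m n) (Hab (n + m)%nat).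
  rewrite (Nat.add_comm m n); lra. }
destruct (completeness (fun x => exists n, x = a n)) as [p [Hp1 Hp2]].
- exists (b O); intros x [n ->]; apply Gab.
- exists (a O), O; reflexivity.
- exists p; intro n; split.
  + apply Hp1; exists n; reflexivity.
  + apply Hp2; intros x [m ->]; apply Gab.
Qed.

(** The combinatorial half of Goursat's argument, for an arbitrary quantity [N] on rectangles. Were
    it positive on the whole rectangle, with value K, then keeping at each quartering a piece with
    at least a fourth of the value would give nested rectangles with [N] at least K / 4^n, against
    the local bound eta L^2 / 4^n at their common point. *)
Lemma bisection (N : R -> R -> R -> R -> R) (a0 b0 c0 d0 : R) :
  a0 <= b0 -> c0 <= d0 ->
  (forall a b c d, a0 <= a <= b -> b <= b0 -> c0 <= c <= d -> d <= d0 ->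
     N a b c d <= N a ((a + b) / 2) c ((c + d) / 2) + N ((a + b) / 2) b c ((c + d) / 2)
                + (N a ((a + b) / 2) ((c + d) / 2) d + N ((a + b) / 2) b ((c + d) / 2) d)) ->
  (forall p q eta, a0 <= p <= b0 -> c0 <= q <= d0 -> 0 < eta ->
     exists delta, 0 < delta /\ forall a b c d,
       a0 <= a <= p -> p <= b <= b0 -> c0 <= c <= q -> q <= d <= d0 ->
       b - a < delta -> d - c < delta -> N a b c d <= eta * (b - a + (d - c)) ^ 2) ->
  N a0 b0 c0 d0 <= 0.
Proof.
intros Hab Hcd Hsub Hloc.
destruct (Rle_lt_dec (N a0 b0 c0 d0) 0) as [H0|H0]; [exact H0|exfalso].
pose (P := fun r : R * R * R * R => let '(a, b, c, d) := r in N a b c d).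
(* The last quarter is taken by default; subadditivity then guarantees its share. *)
pose (step := fun r : R * R * R * R => let '(a, b, c, d) := r in
  let m := (a + b) / 2 in let k := (c + d) / 2 in
  if Rle_dec (N a b c d / 4) (N a m c k) then (a, m, c, k)
  else if Rle_dec (N a b c d / 4) (N m b c k) then (m, b, c, k)
  else if Rle_dec (N a b c d / 4) (N a m k d) then (a, m, k, d)
  else (m, b, k, d)).
pose (s := fix s n := match n with O => (a0, b0, c0, d0) | S n' => step (s n') end).
pose (sa := fun n => let '(a, b, c, d) := s n in a).
pose (sb := fun n => let '(a, b, c, d) := s n in b).
pose (sc := fun n => let '(a, b, c, d) := s n in c).
pose (sd := fun n => let '(a, b, c, d) := s n in d).
assert (Hinv : forall n, a0 <= sa n <= sb n /\ sb n <= b0 /\ c0 <= sc n <= sd n /\ sd n <= d0).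
{ intro n; unfold sa, sb, sc, sd; induction n as [|n IH]; [simpl; lra|].
  change (s (S n)) with (step (s n)).
  destruct (s n) as [[[a b] c] d]; unfold step.
  destruct (Rle_dec _ _); [|destruct (Rle_dec _ _); [|destruct (Rle_dec _ _)]]; lra. }
assert (Hstep : forall n, sa n <= sa (S n) /\ sb (S n) <= sb n /\ sc n <= sc (S n)
   /\ sd (S n) <= sd n /\ sb (S n) - sa (S n) = (sb n - sa n) / 2
   /\ sd (S n) - sc (S n) = (sd n - sc n) / 2
   /\ N (sa n) (sb n) (sc n) (sd n) / 4 <= N (sa (S n)) (sb (S n)) (sc (S n)) (sd (S n))).
{ intro n; generalize (Hinv n); unfold sa, sb, sc, sd.
  change (s (S n)) with (step (s n)).
  destruct (s n) as [[[a b] c] d]; unfold step; intro HI.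
  assert (HN := Hsub a b c d ltac:(lra) ltac:(lra) ltac:(lra) ltac:(lra)).
  destruct (Rle_dec _ _); [|destruct (Rle_dec _ _); [|destruct (Rle_dec _ _)]];
    repeat split; lra. }
assert (Hsize : forall n, sb n - sa n = (b0 - a0) / 2 ^ n /\ sd n - sc n = (d0 - c0) / 2 ^ n
    /\ N a0 b0 c0 d0 / 4 ^ n <= N (sa n) (sb n) (sc n) (sd n)).
{ induction n as [|n [IH1 [IH2 IH3]]].
  - unfold sa, sb, sc, sd; simpl; repeat split; lra.
  - destruct (Hstep n) as [_ [_ [_ [_ [E1 [E2 E3]]]]]].
    rewrite E1, E2, IH1, IH2.
    assert (T2 : 2 ^ n <> 0) by (apply pow_nonzero; lra).
    assert (T4 : 4 ^ n <> 0) by (apply pow_nonzero; lra).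
    replace (N a0 b0 c0 d0 / 4 ^ S n) with (N a0 b0 c0 d0 / 4 ^ n / 4)
      by (simpl; field; exact T4).
    repeat split; [simpl; field; exact T2|simpl; field; exact T2|lra]. }
destruct (nested_intervals_point sa sb) as [p Hp];
  [intro n; apply Hstep|intro n; apply Hstep|intro n; apply Hinv|].
destruct (nested_intervals_point sc sd) as [q Hq];
  [intro n; apply Hstep|intro n; apply Hstep|intro n; apply Hinv|].
set (L := b0 - a0 + (d0 - c0)).
set (K := N a0 b0 c0 d0) in *.
(* Chosen so that eta L^2 <= K / 2; the 1 keeps the denominator positive for a degenerate
   rectangle. *)
set (eta := K / (2 * (L ^ 2 + 1))).
assert (HL : 0 <= L) by (unfold L; lra).
assert (Heta : 0 < eta).
{ apply Rdiv_lt_0_compat; [exact H0|]; generalize (pow2_ge_0 L); lra. }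
destruct (Hloc p q eta) as [delta [Hd Hd']];
  [generalize (Hp O); unfold sa, sb; simpl; lra
  |generalize (Hq O); unfold sc, sd; simpl; lra|exact Heta|].
destruct (pow_lt_1_zero (/2) ltac:(rewrite Rabs_pos_eq; lra) (delta / (L + 1)))
  as [n Hn].
{ apply Rdiv_lt_0_compat; lra. }
specialize (Hn n (le_n n)).
assert (T2 : 0 < 2 ^ n) by (apply pow_lt; lra).
rewrite Rabs_pos_eq, pow_inv in Hn by (apply pow_le; lra).
assert (Hn' : L / 2 ^ n < delta).
{ apply Rle_lt_trans with ((L + 1) * / 2 ^ n).
  - unfold Rdiv; apply Rmult_le_compat_r; [left; now apply Rinv_0_lt_compat|lra].
  - apply Rmult_lt_compat_l with (r := L + 1) in Hn; [|lra].
    replace ((L + 1) * (delta / (L + 1))) with delta in Hn by (field; lra).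
    exact Hn. }
destruct (Hsize n) as [S1 [S2 S3]].
assert (Hpow : N a0 b0 c0 d0 / 4 ^ n <= eta * (L / 2 ^ n) ^ 2).
{ apply Rle_trans with (1 := S3).
  replace (L / 2 ^ n) with (sb n - sa n + (sd n - sc n))
    by (rewrite S1, S2; unfold L; field; lra).
  assert (Le : forall x y, 0 <= x -> 0 <= y -> x + y = L / 2 ^ n -> x < delta /\ y < delta)
    by (intros; lra).
  destruct (Le (sb n - sa n) (sd n - sc n)) as [Le1 Le2].
  - generalize (Hinv n); lra.
  - generalize (Hinv n); lra.
  - rewrite S1, S2; unfold L; field; lra.
  - generalize (Hp n) (Hq n) (Hinv n); intros ? ? ?.
    apply Hd'; lra. }
fold K in Hpow.
replace ((L / 2 ^ n) ^ 2) with (L ^ 2 / 4 ^ n) in Hpow.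
2:{ replace 4 with (2 * 2) by ring. rewrite Rpow_mult_distr; field; lra. }
assert (T4 : 0 < 4 ^ n) by (apply pow_lt; lra).
assert (Hfin : K <= eta * L ^ 2).
{ apply Rmult_le_reg_r with (/ 4 ^ n); [now apply Rinv_0_lt_compat|].
  unfold Rdiv in Hpow; lra. }
assert (HP : 0 <= L ^ 2) by apply pow2_ge_0.
assert (Hc : eta * L ^ 2 <= K / 2).
{ unfold eta. apply Rmult_le_reg_r with (2 * (L ^ 2 + 1)); [lra|].
  field_simplify; [nra|lra]. }
lra.
Qed.

(** * Contour integrals along differentiable paths *)

Lemma Cnorm_Cmod (z : C) : Cnorm z = Cmod z.
Proof. unfold Cnorm, Cmod; f_equal; ring. Qed.

Lemma norm_Cmod (z : C) : @norm _ C_R_NormedModule z = Cmod z.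
Proof.
unfold Cmod, norm; simpl; unfold prod_norm, norm; simpl; unfold abs; simpl.
f_equal; rewrite !Rmult_1_r, <- !Rabs_mult, !Rabs_pos_eq; auto; apply Rle_0_sqr.
Qed.

Lemma is_RInt_pair (f : R -> C) (a b : R) (l : C) :
  is_RInt (fun t => fst (f t)) a b (fst l) -> is_RInt (fun t => snd (f t)) a b (snd l) ->
  is_RInt f a b l.
Proof.
destruct l as [l1 l2]; apply (is_RInt_fct_extend_pair (U := R_NormedModule) (V := R_NormedModule)).
Qed.

Lemma continuous_pair (f : R -> C) (t : R) :
  continuous (fun s => fst (f s)) t -> continuous (fun s => snd (f s)) t -> continuous f t.
Proof.
intros H1 H2 P [eps HP].
generalize (H1 _ (locally_ball _ eps)) (H2 _ (locally_ball _ eps)).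
intros [d1 G1] [d2 G2].
exists (mkposreal _ (Rmin_stable_in_posreal d1 d2)); intros s Hs; apply HP; split.
- apply G1; eapply Rlt_le_trans; [exact Hs|apply Rmin_l].
- apply G2; eapply Rlt_le_trans; [exact Hs|apply Rmin_r].
Qed.

Lemma continuous_Re (f : R -> C) t : continuous f t -> continuous (fun s => fst (f s)) t.
Proof. intro H; apply continuous_comp; [exact H|apply continuous_fst]. Qed.

Lemma continuous_Im (f : R -> C) t : continuous f t -> continuous (fun s => snd (f s)) t.
Proof. intro H; apply continuous_comp; [exact H|apply continuous_snd]. Qed.

Lemma continuous_Cplus (f g : R -> C) t :
  continuous f t -> continuous g t -> continuous (fun s => (f s + g s)%C) t.
Proof. exact (continuous_plus (V := C_R_NormedModule) f g t). Qed.

Lemma continuous_Cmult (f g : R -> C) t :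
  continuous f t -> continuous g t -> continuous (fun s => (f s * g s)%C) t.
Proof.
intros Hf Hg; generalize (continuous_Re _ _ Hf) (continuous_Im _ _ Hf)
  (continuous_Re _ _ Hg) (continuous_Im _ _ Hg); intros.
apply continuous_pair; simpl.
- apply (continuous_minus (V := R_NormedModule));
    apply (continuous_mult (K := R_AbsRing)); assumption.
- apply (continuous_plus (V := R_NormedModule));
    apply (continuous_mult (K := R_AbsRing)); assumption.
Qed.

(** Componentwise, so that differentiation rules and the fundamental theorem of calculus for real
    functions apply to each coordinate. *)
Definition is_pderiv (u : R -> C) (t : R) (l : C) : Prop :=
  is_derive (fun s => fst (u s)) t (fst l) /\ is_derive (fun s => snd (u s)) t (snd l).

Lemma is_pderiv_continuous u t l : is_pderiv u t l -> continuous u t.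
Proof.
intros [H1 H2]; apply continuous_pair;
  apply (ex_derive_continuous (V := R_NormedModule)); eexists; eassumption.
Qed.

Lemma Cmod_RInt_le (f : R -> C) a b l M :
  a <= b -> (forall t, a <= t <= b -> Cmod (f t) <= M) -> is_RInt f a b l ->
  Cmod l <= M * (b - a).
Proof.
intros Hab Hf Hl.
rewrite <- norm_Cmod.
apply (norm_RInt_le (V := C_R_NormedModule) f (fun _ => M) a b l (M * (b - a))); auto.
{ intros t Ht; rewrite norm_Cmod; auto. }
replace (M * (b - a)) with (scal (b - a) M) by (unfold scal; simpl; unfold mult; simpl; ring).
apply (is_RInt_const a b M).
Qed.

(* A primitive of [fun z => A + B * z]. *)
Definition quad (A B z : C) : C := (A * z + B * RtoC (/ 2) * (z * z))%C.

(** [quad A B (u t)] is an antiderivative of the integrand, and the fundamental theorem of calculus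
    applies in each coordinate. *)
Lemma is_RInt_affine_path (u u' : R -> C) (A B : C) a b :
  (forall t, is_pderiv u t (u' t)) -> (forall t, continuous u' t) ->
  is_RInt (fun t => ((A + B * u t) * u' t)%C) a b (quad A B (u b) - quad A B (u a))%C.
Proof.
intros Hu Hc.
assert (HD : forall t, is_pderiv (fun s => quad A B (u s)) t ((A + B * u t) * u' t)%C).
{ intro t; destruct (Hu t) as [H1 H2].
  assert (E1 : ex_derive (fun s => fst (u s)) t) by (eexists; eassumption).
  assert (E2 : ex_derive (fun s => snd (u s)) t) by (eexists; eassumption).
  set (u1 := fun s => fst (u s)) in *; set (u2 := fun s => snd (u s)) in *.
  apply is_derive_unique in H1; apply is_derive_unique in H2.
  split.
  - apply (is_derive_ext (fun s => fst A * u1 s - snd A * u2 s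
      + (fst B / 2 * (u1 s * u1 s - u2 s * u2 s) - snd B * (u1 s * u2 s)))).
    + intro s; unfold quad, u1, u2; simpl; field.
    + auto_derive; [tauto|].
      replace (Derive (fun x => u1 x) t) with (fst (u' t)) by (symmetry; exact H1).
      replace (Derive (fun x => u2 x) t) with (snd (u' t)) by (symmetry; exact H2).
      unfold u1, u2; simpl; field.
  - apply (is_derive_ext (fun s => fst A * u2 s + snd A * u1 s
      + (fst B * (u1 s * u2 s) + snd B / 2 * (u1 s * u1 s - u2 s * u2 s)))).
    + intro s; unfold quad, u1, u2; simpl; field.
    + auto_derive; [tauto|].
      replace (Derive (fun x => u1 x) t) with (fst (u' t)) by (symmetry; exact H1).
      replace (Derive (fun x => u2 x) t) with (snd (u' t)) by (symmetry; exact H2).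
      unfold u1, u2; simpl; field. }
assert (HC : forall t, continuous (fun s => ((A + B * u s) * u' s)%C) t).
{ intro t; apply continuous_Cmult; [|apply Hc].
  apply continuous_Cplus; [apply continuous_const|].
  apply continuous_Cmult; [apply continuous_const|eapply is_pderiv_continuous, Hu]. }
apply is_RInt_pair.
- exact (is_RInt_derive (V := R_CompleteNormedModule) (fun s => fst (quad A B (u s))) _ a b
    (fun t _ => proj1 (HD t)) (fun t _ => continuous_Re _ t (HC t))).
- exact (is_RInt_derive (V := R_CompleteNormedModule) (fun s => snd (quad A B (u s))) _ a b
    (fun t _ => proj2 (HD t)) (fun t _ => continuous_Im _ t (HC t))).
Qed.

(** The contour integral of [G] along [u], with the velocity [u'] passed separately. [RInt] is
    total; integrability comes from [is_RInt_pint]. *)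
Definition pint (G : C -> C) (u u' : R -> C) (a b : R) : C :=
  RInt (V := C_R_CompleteNormedModule) (fun t => (G (u t) * u' t)%C) a b.

Lemma continuous_cderiv (G : C -> C) (u : R -> C) t l :
  is_cderiv G (u t) l -> continuous u t -> continuous (fun s => G (u s)) t.
Proof.
intros HG Hu P [eps HP].
destruct (HG 1 Rlt_0_1) as [d [Hd HG']].
set (K := 1 + Cmod l).
assert (HK : 0 < K) by (unfold K; generalize (Cmod_ge_0 l); lra).
assert (He : 0 < Rmin d (eps / K)).
{ apply Rmin_pos; [exact Hd|apply Rdiv_lt_0_compat; [apply eps|exact HK]]. }
assert (HL : locally (u t) (fun z : C => Cmod (z - u t)%C < Rmin d (eps / K))).
{ apply (locally_le_locally_norm (V := C_R_NormedModule)).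
  exists (mkposreal _ He); intros y Hy; rewrite <- norm_Cmod; exact Hy. }
generalize (Hu _ HL); unfold filtermap; apply filter_imp; intros s Hs; apply HP.
set (h := (u s - u t)%C) in *.
assert (Hh : Cmod h < d) by (eapply Rlt_le_trans; [exact Hs|apply Rmin_l]).
assert (Hh2 : Cmod h < eps / K) by (eapply Rlt_le_trans; [exact Hs|apply Rmin_r]).
assert (E := HG' h ltac:(rewrite Cnorm_Cmod; exact Hh)).
rewrite !Cnorm_Cmod in E.
change (Cmod (G (u t + h) - G (u t) - l * h)%C <= 1 * Cmod h) in E.
replace (u t + h)%C with (u s) in E by (unfold h; ring).
apply (norm_compat1 (V := C_R_NormedModule)).
change (@norm _ C_R_NormedModule (G (u s) - G (u t))%C < eps); rewrite norm_Cmod.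
replace (G (u s) - G (u t))%C with (G (u s) - G (u t) - l * h + l * h)%C by ring.
apply Rle_lt_trans with (1 := Cmod_triangle _ _).
rewrite Cmod_mult.
apply Rmult_lt_compat_r with (r := K) in Hh2; [|exact HK].
replace (eps / K * K) with (pos eps) in Hh2 by (field; lra).
unfold K in Hh2; lra.
Qed.

(** Differentiability at one point, the local condition on which Goursat's argument runs. *)
Definition hol_at (G : C -> C) (z : C) : Prop := exists l, is_cderiv G z l.

Lemma is_RInt_pint G u u' a b : a <= b ->
  (forall t, is_pderiv u t (u' t)) -> (forall t, continuous u' t) ->
  (forall t, a <= t <= b -> hol_at G (u t)) ->
  is_RInt (fun t => (G (u t) * u' t)%C) a b (pint G u u' a b).
Proof.
intros Hab Hu Hc HG.
apply (RInt_correct (V := C_R_CompleteNormedModule)), ex_RInt_continuous.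
intros t Ht; rewrite Rmin_left, Rmax_right in Ht by exact Hab.
destruct (HG t Ht) as [l Hl].
apply continuous_Cmult; [|apply Hc].
apply continuous_cderiv with (1 := Hl); eapply is_pderiv_continuous, Hu.
Qed.

Lemma pint_Chasles G u u' a m b : a <= m <= b ->
  (forall t, is_pderiv u t (u' t)) -> (forall t, continuous u' t) ->
  (forall t, a <= t <= b -> hol_at G (u t)) ->
  (pint G u u' a b = pint G u u' a m + pint G u u' m b)%C.
Proof.
intros Hm Hu Hc HG; symmetry.
apply (RInt_Chasles (V := C_R_CompleteNormedModule)); eexists; apply is_RInt_pint;
  auto; try lra; intros; apply HG; lra.
Qed.

(** The affine part is integrated exactly, so only the deviation [E] times the speed bound [K] is
    left under the integral. *)
Lemma pint_affine_error G u u' A B a b E K : a <= b -> 0 <= E ->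
  (forall t, is_pderiv u t (u' t)) -> (forall t, continuous u' t) ->
  (forall t, a <= t <= b -> hol_at G (u t)) ->
  (forall t, a <= t <= b -> Cmod (u' t) <= K) ->
  (forall t, a <= t <= b -> Cmod (G (u t) - (A + B * u t))%C <= E) ->
  Cmod (pint G u u' a b - (quad A B (u b) - quad A B (u a)))%C <= E * K * (b - a).
Proof.
intros Hab HE Hu Hc HG HK HGE.
assert (I1 := is_RInt_pint G u u' a b Hab Hu Hc HG).
assert (I2 := is_RInt_affine_path u u' A B a b Hu Hc).
refine (Cmod_RInt_le _ a b _ (E * K) Hab _
  (is_RInt_minus (V := C_R_NormedModule) _ _ _ _ _ _ I1 I2)).
intros t Ht.
change (Cmod (G (u t) * u' t - (A + B * u t) * u' t)%C <= E * K).
replace (G (u t) * u' t - (A + B * u t) * u' t)%C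
  with ((G (u t) - (A + B * u t)) * u' t)%C by ring.
rewrite Cmod_mult; apply Rmult_le_compat; auto using Cmod_ge_0.
Qed.

Lemma path_lipschitz u u' a b K :
  (forall t, is_pderiv u t (u' t)) -> (forall t, continuous u' t) ->
  (forall t, a <= t <= b -> Cmod (u' t) <= K) ->
  forall s t, a <= s <= b -> a <= t <= b -> Cmod (u s - u t)%C <= K * Rabs (s - t).
Proof.
intros Hu Hc HK.
assert (Hle : forall s t, a <= s <= b -> a <= t <= b -> s <= t ->
  Cmod (u t - u s)%C <= K * (t - s)).
{ intros s t Hs Ht Hst.
  (* With coefficients 1 and 0 the affine integrand is 1, whose integral along the path is the
     displacement. *)
  assert (I := is_RInt_affine_path u u' 1 0 s t Hu Hc).
  unfold quad in I.
  replace (u t - u s)%C with (1 * u t + 0 * RtoC (/ 2) * (u t * u t)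
     - (1 * u s + 0 * RtoC (/ 2) * (u s * u s)))%C by ring.
  apply Cmod_RInt_le with (1 := Hst) (3 := I).
  intros r Hr; replace ((1 + 0 * u r) * u' r)%C with (u' r) by ring.
  apply HK; lra. }
intros s t Hs Ht; destruct (Rle_dec s t) as [Hst|Hst].
- rewrite Rabs_left1 by lra.
  replace (u s - u t)%C with (- (u t - u s))%C by ring; rewrite Cmod_opp.
  replace (- (s - t)) with (t - s) by ring; auto.
- rewrite Rabs_pos_eq by lra; apply Hle; lra.
Qed.

(** * Goursat's theorem on a parameter rectangle *)

(** The contour integral along the image under [P] of the counterclockwise boundary of [a, b] x
    [c, d]; [P1] and [P2] stand for the partial derivatives of [P]. *)
Definition bdry_int (G : C -> C) (P P1 P2 : R -> R -> C) (a b c d : R) : C :=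
  (pint G (fun l => P l c) (fun l => P1 l c) a b + pint G (P b) (P2 b) c d
   - pint G (fun l => P l d) (fun l => P1 l d) a b - pint G (P a) (P2 a) c d)%C.

(** Inner edges cancel under quartering, which gives subadditivity. Near a point of
    differentiability [G] is affine up to a small multiple of the distance; the affine part has a
    primitive and integrates to 0 around the boundary, and what is left is quadratic in the side
    lengths. *)
Lemma goursat (G : C -> C) (P P1 P2 : R -> R -> C) (a0 b0 c0 d0 K : R) :
  a0 <= b0 -> c0 <= d0 -> 0 < K ->
  (forall l t, is_pderiv (fun s => P s t) l (P1 l t)) ->
  (forall l t, is_pderiv (P l) t (P2 l t)) ->
  (forall l t, continuous (fun s => P1 s t) l) ->
  (forall l t, continuous (P2 l) t) ->
  (forall l t, a0 <= l <= b0 -> c0 <= t <= d0 -> Cmod (P1 l t) <= K /\ Cmod (P2 l t) <= K) ->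
  (forall l t, a0 <= l <= b0 -> c0 <= t <= d0 -> hol_at G (P l t)) ->
  bdry_int G P P1 P2 a0 b0 c0 d0 = 0%C.
Proof.
intros Hab Hcd HK HP1 HP2 HC1 HC2 HB HG.
apply Cmod_eq_0, Rle_antisym; [|apply Cmod_ge_0].
apply (bisection (fun a b c d => Cmod (bdry_int G P P1 P2 a b c d)) a0 b0 c0 d0 Hab Hcd).
- intros a b c d Ha Hb Hc Hd.
  set (m := (a + b) / 2); set (k := (c + d) / 2).
  assert (Hm : a <= m <= b) by (unfold m; lra).
  assert (Hk : c <= k <= d) by (unfold k; lra).
  eapply Rle_trans; [|apply Rplus_le_compat; apply Cmod_triangle].
  eapply Rle_trans; [|apply Cmod_triangle].
  apply Req_le; f_equal; unfold bdry_int.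
  rewrite (pint_Chasles G (fun l => P l c) (fun l => P1 l c) a m b);
    [|exact Hm|intro; apply HP1|intro; apply HC1|intros; apply HG; lra].
  rewrite (pint_Chasles G (fun l => P l d) (fun l => P1 l d) a m b);
    [|exact Hm|intro; apply HP1|intro; apply HC1|intros; apply HG; lra].
  rewrite (pint_Chasles G (P b) (P2 b) c k d);
    [|exact Hk|intro; apply HP2|intro; apply HC2|intros; apply HG; lra].
  rewrite (pint_Chasles G (P a) (P2 a) c k d);
    [|exact Hk|intro; apply HP2|intro; apply HC2|intros; apply HG; lra].
  ring.
- intros p q eta Hp Hq Heta.
  destruct (HG p q Hp Hq) as [L HL].
  assert (HK2 : 0 < 2 * K ^ 2) by (generalize (pow_lt K 2 HK); lra).
  (* The four edges will contribute 2 E K S with E = eta / (2 K^2) times K S, hence exactly eta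
     S^2. *)
  destruct (HL (eta / (2 * K ^ 2))) as [delta [Hdelta HL']].
  { apply Rdiv_lt_0_compat; assumption. }
  exists (delta / (2 * K)); split; [apply Rdiv_lt_0_compat; lra|].
  intros a b c d Ha Hb Hc Hd Hab' Hcd'.
  set (S := b - a + (d - c)).
  assert (HS : 0 <= S) by (unfold S; lra).
  assert (HKS : K * S < delta).
  { replace delta with (K * (delta / (2 * K) + delta / (2 * K))) by (field; lra).
    apply Rmult_lt_compat_l; unfold S; lra. }
  set (E := eta / (2 * K ^ 2) * (K * S)).
  assert (HE : 0 <= E).
  { unfold E; apply Rmult_le_pos; [left; now apply Rdiv_lt_0_compat|].
    apply Rmult_le_pos; lra. }
  set (A := (G (P p q) - L * P p q)%C).
  assert (HGE : forall l t, a <= l <= b -> c <= t <= d ->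
    Cmod (G (P l t) - (A + L * P l t))%C <= E).
  { intros l t Hl Ht.
    assert (Hdist : Cmod (P l t - P p q)%C <= K * S).
    { replace (P l t - P p q)%C with ((P l t - P p t) + (P p t - P p q))%C by ring.
      apply Rle_trans with (1 := Cmod_triangle _ _).
      assert (T1 := path_lipschitz (fun s => P s t) (fun s => P1 s t) a b K
         (fun s => HP1 s t) (fun s => HC1 s t)
         (fun s Hs => proj1 (HB s t ltac:(lra) ltac:(lra))) l p Hl ltac:(lra)).
      assert (T2 := path_lipschitz (P p) (P2 p) c d K
         (fun s => HP2 p s) (fun s => HC2 p s)
         (fun s Hs => proj2 (HB p s ltac:(lra) ltac:(lra))) t q Ht ltac:(lra)).
      assert (R1 : Rabs (l - p) <= b - a) by (apply Rabs_le; lra).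
      assert (R2 : Rabs (t - q) <= d - c) by (apply Rabs_le; lra).
      apply Rmult_le_compat_l with (r := K) in R1; [|lra].
      apply Rmult_le_compat_l with (r := K) in R2; [|lra].
      unfold S; simpl in T1; lra. }
    specialize (HL' (P l t - P p q)%C).
    rewrite !Cnorm_Cmod in HL'.
    specialize (HL' ltac:(lra)).
    change (Cmod (G (P p q + (P l t - P p q)) - G (P p q) - L * (P l t - P p q))%C
      <= eta / (2 * K ^ 2) * Cmod (P l t - P p q)%C) in HL'.
    replace (P p q + (P l t - P p q))%C with (P l t) in HL' by ring.
    replace (G (P l t) - (A + L * P l t))%C
      with (G (P l t) - G (P p q) - L * (P l t - P p q))%C by (unfold A; ring).
    apply Rle_trans with (1 := HL'); unfold E.
    apply Rmult_le_compat_l; [left; now apply Rdiv_lt_0_compat|exact Hdist]. }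
  assert (V : forall t, c <= t <= d -> Cmod (pint G (fun l => P l t) (fun l => P1 l t) a b
     - (quad A L (P b t) - quad A L (P a t)))%C <= E * K * (b - a)).
  { intros t Ht; apply (pint_affine_error G (fun l => P l t) (fun l => P1 l t)); auto.
    - lra.
    - intros; apply HG; lra.
    - intros; apply HB; lra. }
  assert (H : forall l, a <= l <= b -> Cmod (pint G (P l) (P2 l) c d
     - (quad A L (P l d) - quad A L (P l c)))%C <= E * K * (d - c)).
  { intros l Hl; apply (pint_affine_error G (P l) (P2 l)); auto.
    - lra.
    - intros; apply HG; lra.
    - intros; apply HB; lra. }
  assert (V1 := V c ltac:(lra)); assert (V2 := V d ltac:(lra)).
  assert (H1 := H b ltac:(lra)); assert (H2 := H a ltac:(lra)).
  revert V1 V2 H1 H2; unfold bdry_int.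
  set (v1 := pint _ _ _ a b); set (v2 := pint _ _ _ a b).
  set (h1 := pint _ _ _ c d); set (h2 := pint _ _ _ c d).
  intros V1 V2 H1 H2.
  (* The values of the primitive at the four corners cancel, so four edge errors remain. *)
  replace (v1 + h1 - v2 - h2)%C
    with ((v1 - (quad A L (P b c) - quad A L (P a c)))
        + (h1 - (quad A L (P b d) - quad A L (P b c)))
        + (- (v2 - (quad A L (P b d) - quad A L (P a d)))
        + - (h2 - (quad A L (P a d) - quad A L (P a c)))))%C by ring.
  eapply Rle_trans; [apply Cmod_triangle|].
  eapply Rle_trans; [apply Rplus_le_compat; apply Cmod_triangle|].
  rewrite !Cmod_opp.
  replace (eta * S ^ 2)
    with (E * K * (b - a) + E * K * (d - c) + (E * K * (b - a) + E * K * (d - c)));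
    [lra|unfold E, S; field; lra].
Qed.

Lemma Cmod_sub_ge (z w : C) : Cmod z - Cmod w <= Cmod (z - w)%C.
Proof.
generalize (Cmod_triangle (z - w)%C w); replace (z - w + w)%C with z by ring; lra.
Qed.

Lemma is_RInt_Cmult_l (k : C) (f : R -> C) a b l :
  is_RInt f a b l -> is_RInt (fun t => (k * f t)%C) a b (k * l)%C.
Proof.
intro H.
assert (H1 := is_RInt_fct_extend_fst (U := R_NormedModule) (V := R_NormedModule) f a b l H).
assert (H2 := is_RInt_fct_extend_snd (U := R_NormedModule) (V := R_NormedModule) f a b l H).
apply is_RInt_pair; simpl.
- apply (is_RInt_minus (V := R_NormedModule));
    apply (is_RInt_scal (V := R_NormedModule)); assumption.
- apply (is_RInt_plus (V := R_NormedModule));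
    apply (is_RInt_scal (V := R_NormedModule)); assumption.
Qed.

Lemma is_RInt_Cconst (k : C) a b : is_RInt (fun _ => k) a b (RtoC (b - a) * k)%C.
Proof.
replace (RtoC (b - a) * k)%C with (scal (b - a) k : C_R_NormedModule);
  [apply (is_RInt_const (V := C_R_NormedModule))|].
destruct k; unfold scal; simpl; unfold prod_scal, scal; simpl; unfold mult; simpl.
apply injective_projections; simpl; ring.
Qed.

Lemma hol_at_const k z : hol_at (fun _ => k) z.
Proof.
exists (RtoC 0); intros e He; exists 1; split; [lra|].
refine (fun (h : C) _ => _); rewrite !Cnorm_Cmod.
change (Cmod (k - k - 0 * h)%C <= e * Cmod h).
replace (k - k - 0 * h)%C with (RtoC 0) by ring; rewrite Cmod_0.
apply Rmult_le_pos; [lra|apply Cmod_ge_0].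
Qed.

(** The quotient rule with [a = p - w]: the derivative is [L] and the error is (E - L h^2) / (a +
    h), where [E] is the error of [f]. *)
Lemma hol_at_cauchy_kernel f w p : hol_at f p -> p <> w -> hol_at (fun z => f z / (z - w))%C p.
Proof.
intros [l Hl] Hpw; set (a := (p - w)%C).
assert (Ha : a <> 0%C).
{ intro E; apply Hpw; replace p with (a + w)%C by (unfold a; ring); rewrite E; ring. }
assert (Ha' := proj1 (Cmod_gt_0 a) Ha).
set (L := ((l - f p / a) / a)%C); exists L; intros e He.
destruct (Hl (e * Cmod a / 4)) as [d [Hd Hf]].
{ apply Rdiv_lt_0_compat; [apply Rmult_lt_0_compat; assumption|lra]. }
assert (HL := Cmod_ge_0 L).
(* The three bounds control [E], ensure |a + h| >= |a| / 2, and give |L| |h| <= e |a| / 4. *)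
exists (Rmin d (Rmin (Cmod a / 2) (e * Cmod a / (4 * (Cmod L + 1))))); split.
{ repeat apply Rmin_pos; [exact Hd|lra|].
  apply Rdiv_lt_0_compat; [apply Rmult_lt_0_compat; assumption|lra]. }
refine (fun (h : C) Hh => _); specialize (Hf h); revert Hf Hh; rewrite !Cnorm_Cmod; intros Hf Hh.
assert (H1 : Cmod h < d) by (eapply Rlt_le_trans; [exact Hh|apply Rmin_l]).
assert (H2 : Cmod h < Cmod a / 2).
{ eapply Rlt_le_trans; [exact Hh|]; eapply Rle_trans; [apply Rmin_r|apply Rmin_l]. }
assert (H3 : Cmod h <= e * Cmod a / (4 * (Cmod L + 1))).
{ left; eapply Rlt_le_trans; [exact Hh|]; eapply Rle_trans; [apply Rmin_r|apply Rmin_r]. }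
specialize (Hf H1).
set (E := (f (p + h) - f p - l * h)%C).
change (Cmod E <= e * Cmod a / 4 * Cmod h) in Hf.
assert (Hah : Cmod a / 2 <= Cmod (a + h)%C).
{ generalize (Cmod_sub_ge a (- h)%C); rewrite Cmod_opp.
  replace (a - - h)%C with (a + h)%C by ring; lra. }
assert (Hah0 : (a + h)%C <> 0%C) by (apply Cmod_gt_0; lra).
change (Cmod (f (p + h) / (p + h - w) - f p / (p - w) - L * h)%C <= e * Cmod h).
replace (f (p + h) / (p + h - w) - f p / (p - w) - L * h)%C with ((E - L * (h * h)) / (a + h))%C.
2:{ unfold E, L; replace (p + h - w)%C with (a + h)%C by (unfold a; ring).
    fold a; field; split; assumption. }
rewrite Cmod_div by exact Hah0.
apply Rmult_le_reg_r with (Cmod (a + h)%C); [lra|].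
unfold Rdiv; rewrite Rmult_assoc, Rinv_l, Rmult_1_r by lra.
apply Rle_trans with (e * Cmod h * (Cmod a / 2)).
2:{ apply Rmult_le_compat_l; [apply Rmult_le_pos; [lra|apply Cmod_ge_0]|exact Hah]. }
apply Rle_trans with (1 := Cmod_triangle _ _); rewrite Cmod_opp, !Cmod_mult.
assert (H4 : Cmod L * Cmod h <= e * Cmod a / 4).
{ apply Rmult_le_compat_l with (r := Cmod L + 1) in H3; [|lra].
  replace ((Cmod L + 1) * (e * Cmod a / (4 * (Cmod L + 1)))) with (e * Cmod a / 4) in H3
    by (field; lra).
  generalize (Cmod_ge_0 h); lra. }
apply Rmult_le_compat_r with (r := Cmod h) in H4; [|apply Cmod_ge_0].
lra.
Qed.

(** * Circles and their deformation *)

Definition circ (r t : R) : C := (r * cos t, r * sin t).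

Lemma Cmod_circ r t : 0 <= r -> Cmod (circ r t) = r.
Proof.
intro Hr; unfold Cmod, circ; simpl.
replace (_ + _) with (r * r * (Rsqr (sin t) + Rsqr (cos t))) by (unfold Rsqr; ring).
rewrite sin2_cos2, Rmult_1_r; now apply sqrt_square.
Qed.

Lemma circ_periodic r : circ r (2 * PI) = circ r 0.
Proof. unfold circ; now rewrite cos_2PI, sin_2PI, cos_0, sin_0. Qed.

Lemma circ_pderiv r t : is_pderiv (circ r) t (Ci * circ r t)%C.
Proof.
split; simpl; (auto_derive; [exact I|ring]).
Qed.

Lemma circ_continuous r t : continuous (circ r) t.
Proof. eapply is_pderiv_continuous, circ_pderiv. Qed.

(* The radial segments from [c] to the circle [|z| = r]: as [l] decreases to 0, the loop
   [cone c r l] shrinks from the circle to [c]; for [c = 0] it is the circle of radius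
   [l * r]. *)
Definition cone (c : C) (r l t : R) : C := (c + RtoC l * (circ r t - c))%C.

Lemma cone_pderiv_l c r l t :
  is_pderiv (fun s => cone c r s t) l (circ r t - c)%C.
Proof. split; simpl; (auto_derive; [exact I|ring]). Qed.

Lemma cone_pderiv_t c r l t :
  is_pderiv (cone c r l) t (RtoC l * (Ci * circ r t))%C.
Proof. split; simpl; (auto_derive; [exact I|ring]). Qed.

(** Apply [goursat] on [l0, l1] x [0, 2 pi]: the edges t = 0 and t = 2 pi have the same image and
    cancel, which leaves the two loops. *)
Lemma circle_deformation G c r l0 l1 : 0 < r -> 0 <= l0 <= l1 ->
  (forall l t, l0 <= l <= l1 -> hol_at G (cone c r l t)) ->
  pint G (cone c r l0) (fun t => RtoC l0 * (Ci * circ r t))%C 0 (2 * PI)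
  = pint G (cone c r l1) (fun t => RtoC l1 * (Ci * circ r t))%C 0 (2 * PI).
Proof.
intros Hr Hl HG.
assert (HPI := PI_RGT_0); assert (Hc := Cmod_ge_0 c).
assert (H : bdry_int G (cone c r) (fun l t => circ r t - c)%C
   (fun l t => RtoC l * (Ci * circ r t))%C l0 l1 0 (2 * PI) = 0%C).
{ apply (goursat _ _ _ _ _ _ _ _ (r + Cmod c + l1 * r)).
  - lra.
  - lra.
  - generalize (Rmult_le_pos l1 r); lra.
  - intros; apply cone_pderiv_l.
  - intros; apply cone_pderiv_t.
  - intros; apply continuous_const.
  - intros; apply continuous_Cmult; [apply continuous_const|].
    apply continuous_Cmult; [apply continuous_const|apply circ_continuous].
  - intros l t Hl' Ht; split.
    + apply Rle_trans with (1 := Cmod_triangle _ _); rewrite Cmod_opp, Cmod_circ by lra.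
      generalize (Rmult_le_pos l1 r); lra.
    + rewrite !Cmod_mult, Cmod_circ, Cmod_R, Rabs_pos_eq by lra.
      replace (Cmod Ci) with 1.
      2:{ unfold Cmod; simpl; replace (_ + _) with 1 by ring; symmetry; apply sqrt_1. }
      generalize (Rmult_le_compat_r r l l1); lra.
  - intros; apply HG; assumption. }
unfold bdry_int in H.
assert (E : pint G (fun l => cone c r l (2 * PI)) (fun l => circ r (2 * PI) - c)%C l0 l1
  = pint G (fun l => cone c r l 0) (fun l => circ r 0 - c)%C l0 l1).
{ unfold cone; now rewrite circ_periodic. }
rewrite E in H; revert H.
set (v := pint G _ _ l0 l1); set (h1 := pint G (cone c r l1) _ 0 (2 * PI)).
set (h0 := pint G (cone c r l0) _ 0 (2 * PI)); intro H.
replace h1 with (v + h1 - v - h0 + h0)%C by ring; rewrite H; ring.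
Qed.

Lemma Rle_0_of_small x K e0 : 0 < e0 ->
  (forall e, 0 < e <= e0 -> x <= K * e) -> x <= 0.
Proof.
intros He0 H; destruct (Rle_lt_dec x 0) as [Hx|Hx]; [exact Hx|exfalso].
assert (HK := Rabs_pos K).
(* Small enough for |K| e <= x / 2, against x <= K e. *)
set (e := Rmin e0 (x / (2 * (Rabs K + 1)))).
assert (He : 0 < e).
{ apply Rmin_pos; [exact He0|apply Rdiv_lt_0_compat; lra]. }
assert (H1 := H e (conj He (Rmin_l _ _))).
assert (H2 : e <= x / (2 * (Rabs K + 1))) by apply Rmin_r.
apply Rmult_le_compat_l with (r := Rabs K + 1) in H2; [|lra].
replace ((Rabs K + 1) * (x / (2 * (Rabs K + 1)))) with (x / 2) in H2 by (field; lra).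
generalize (Rmult_le_compat_r e K (Rabs K) (Rlt_le _ _ He) (RRle_abs K)); lra.
Qed.

Lemma Ceq_of_small (z w : C) K e0 : 0 < e0 ->
  (forall e, 0 < e <= e0 -> Cmod (z - w)%C <= K * e) -> z = w.
Proof.
intros He0 H.
replace z with (z - w + w)%C by ring.
rewrite (Cmod_eq_0 (z - w)%C); [ring|].
apply Rle_antisym; [|apply Cmod_ge_0].
now apply Rle_0_of_small with K e0.
Qed.

Lemma Cmod_Ci : Cmod Ci = 1.
Proof. unfold Cmod; simpl; replace (_ + _) with 1 by ring; apply sqrt_1. Qed.

Lemma Ci_neq_0 : Ci <> 0%C.
Proof. apply Cmod_gt_0; rewrite Cmod_Ci; lra. Qed.

Lemma is_RInt_Cext (f g : R -> C) a b l :
  (forall t, f t = g t) -> is_RInt f a b l -> is_RInt g a b l.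
Proof. intros H; apply is_RInt_ext; intros t _; apply H. Qed.

Lemma is_RInt_circle_pint G c r l a b : a <= b ->
  (forall t, a <= t <= b -> hol_at G (cone c r l t)) ->
  is_RInt (fun t => (G (cone c r l t) * (RtoC l * (Ci * circ r t)))%C) a b
    (pint G (cone c r l) (fun t => RtoC l * (Ci * circ r t))%C a b).
Proof.
intros Hab HG; apply is_RInt_pint; [exact Hab|intro; apply cone_pderiv_t| |exact HG].
intro; apply continuous_Cmult; [apply continuous_const|].
apply continuous_Cmult; [apply continuous_const|apply circ_continuous].
Qed.

(** * Cauchy's formula for a function and for its derivative *)

(** Enlarging the circle about 0 by a factor [l >= 1] never meets [w] and leaves the integral of 1 /
    (z - w) unchanged, while the integrand in the parameter tends to the constant i with an error of
    order 1 / l. *)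
Lemma circle_integral_kernel w r : Cmod w < r ->
  is_RInt (fun t => (circ r t / (circ r t - w))%C) 0 (2 * PI) (RtoC (2 * PI)).
Proof.
intro Hw; assert (Hw0 := Cmod_ge_0 w); assert (HPI := PI_RGT_0).
assert (Hr : 0 < r) by lra.
set (G := fun z : C => (1 / (z - w))%C).
assert (Hcone : forall l t, cone 0 r l t = (RtoC l * circ r t)%C)
  by (intros; unfold cone; ring).
assert (Hne : forall l t, 1 <= l -> l * (r - Cmod w) <= Cmod (RtoC l * circ r t - w)%C).
{ intros l t Hl; eapply Rle_trans; [|apply Cmod_sub_ge].
  rewrite Cmod_mult, Cmod_circ, Cmod_R, Rabs_pos_eq by lra.
  generalize (Rmult_le_compat_r (Cmod w) 1 l Hw0 Hl); lra. }
assert (Hpos : forall l, 1 <= l -> 0 < l * (r - Cmod w))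
  by (intros; apply Rmult_lt_0_compat; lra).
assert (Hne0 : forall l t, 1 <= l -> (RtoC l * circ r t - w)%C <> 0%C).
{ intros l t Hl; apply Cmod_gt_0; generalize (Hne l t Hl) (Hpos l Hl); lra. }
assert (HG : forall l t, 1 <= l -> hol_at G (cone 0 r l t)).
{ intros l t Hl; apply (hol_at_cauchy_kernel (fun _ => RtoC 1)); [apply hol_at_const|].
  intro E; apply (Hne0 l t Hl); rewrite <- Hcone, E; ring. }
set (I := pint G (cone 0 r 1) (fun t => RtoC 1 * (Ci * circ r t))%C 0 (2 * PI)).
assert (HI : I = (RtoC (2 * PI) * Ci)%C).
{ apply Ceq_of_small with (2 * PI * (Cmod w / (r - Cmod w))) 1; [lra|].
  intros e He; set (l := / e).
  assert (Hl : 1 <= l) by (unfold l; rewrite <- Rinv_1; apply Rinv_le_contravar; lra).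
  unfold I; rewrite (circle_deformation G 0 r 1 l); [|lra|lra|intros; apply HG; lra].
  assert (J := is_RInt_circle_pint G 0 r l 0 (2 * PI) ltac:(lra)
    (fun t _ => HG l t Hl)).
  assert (J2 := is_RInt_Cconst Ci 0 (2 * PI)); rewrite Rminus_0_r in J2.
  replace (2 * PI * (Cmod w / (r - Cmod w)) * e)
    with (Cmod w / (r - Cmod w) * e * (2 * PI - 0)) by ring.
  refine (Cmod_RInt_le _ 0 (2 * PI) _ _ _ _
    (is_RInt_minus (V := C_R_NormedModule) _ _ _ _ _ _ J J2)); [lra|].
  intros t _; unfold G.
  change (Cmod (1 / (cone 0 r l t - w) * (RtoC l * (Ci * circ r t)) - Ci)%C
    <= Cmod w / (r - Cmod w) * e).
  rewrite Hcone.
  replace (1 / (RtoC l * circ r t - w) * (RtoC l * (Ci * circ r t)) - Ci)%C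
    with (Ci * w / (RtoC l * circ r t - w))%C by (field; apply Hne0, Hl).
  rewrite Cmod_div by (apply Hne0, Hl); rewrite Cmod_mult, Cmod_Ci, Rmult_1_l.
  replace (Cmod w / (r - Cmod w) * e) with (Cmod w / (l * (r - Cmod w)))
    by (unfold l; field; lra).
  apply Rmult_le_compat_l; [exact Hw0|].
  apply Rinv_le_contravar; [apply Hpos|apply Hne]; exact Hl. }
assert (J := is_RInt_circle_pint G 0 r 1 0 (2 * PI) ltac:(lra)
  (fun t _ => HG 1 t (Rle_refl 1))).
apply (is_RInt_Cmult_l (/ Ci)) in J; fold I in J; rewrite HI in J.
replace (RtoC (2 * PI)) with (/ Ci * (RtoC (2 * PI) * Ci))%C by (field; apply Ci_neq_0).
revert J; apply is_RInt_Cext; intros t; unfold G; rewrite Hcone.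
assert (N := Hne0 1 t (Rle_refl 1)); rewrite Cmult_1_l in N |- *.
field; split; [exact N|apply Ci_neq_0].
Qed.

(** Contract the circle towards [w]. The kernel f(z) / (z - w) is differentiable wherever l > 0, so
    the integral stays constant; the factors [l] of z - w and dz cancel, f(z) tends to f(w), and
    [circle_integral_kernel] evaluates the limit. *)
Lemma cauchy_formula f w r : Cmod w < r ->
  (forall z, Cmod z <= r -> hol_at f z) ->
  is_RInt (fun t => (f (circ r t) * (circ r t / (circ r t - w)))%C) 0 (2 * PI)
    (RtoC (2 * PI) * f w)%C.
Proof.
intros Hw Hf; assert (Hw0 := Cmod_ge_0 w); assert (HPI := PI_RGT_0).
assert (Hr : 0 < r) by lra.
set (G := fun z : C => (f z / (z - w))%C).
assert (Hne : forall t, r - Cmod w <= Cmod (circ r t - w)%C).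
{ intros t; eapply Rle_trans; [|apply Cmod_sub_ge]; rewrite Cmod_circ; lra. }
assert (Hne0 : forall t, (circ r t - w)%C <> 0%C).
{ intros t; apply Cmod_gt_0; generalize (Hne t); lra. }
assert (Hcone : forall l t, 0 <= l <= 1 -> Cmod (cone w r l t) <= r).
{ intros l t Hl; unfold cone.
  replace (w + RtoC l * (circ r t - w))%C with (RtoC (1 - l) * w + RtoC l * circ r t)%C
    by (rewrite RtoC_minus; ring).
  apply Rle_trans with (1 := Cmod_triangle _ _).
  rewrite !Cmod_mult, !Cmod_R, Cmod_circ, !Rabs_pos_eq by lra.
  generalize (Rmult_le_compat_l (1 - l) (Cmod w) r); lra. }
assert (Hsub : forall l t, (cone w r l t - w = RtoC l * (circ r t - w))%C)
  by (intros; unfold cone; ring).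
assert (Hl0 : forall l, 0 < l -> RtoC l <> 0%C).
{ intros l Hl E; apply (f_equal fst) in E; simpl in E; lra. }
assert (HG : forall l t, 0 < l <= 1 -> hol_at G (cone w r l t)).
{ intros l t Hl; apply hol_at_cauchy_kernel.
  - apply Hf, Hcone; lra.
  - intro E; apply (Cmult_neq_0 (RtoC l) (circ r t - w)%C); [apply Hl0; lra|apply Hne0|].
    rewrite <- Hsub, E; ring. }
set (I := pint G (cone w r 1) (fun t => RtoC 1 * (Ci * circ r t))%C 0 (2 * PI)).
assert (JK := is_RInt_Cmult_l (f w * Ci) _ _ _ _ (circle_integral_kernel w r Hw)).
assert (HI : I = (f w * Ci * RtoC (2 * PI))%C).
{ apply Ceq_of_small with (2 * PI * (r / (r - Cmod w))) 1; [lra|].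
  intros e He.
  destruct (Hf w ltac:(lra)) as [L HL].
  destruct (HL e ltac:(lra)) as [d [Hd HL']].
  assert (HLp := Cmod_ge_0 L).
  assert (Hsmall : exists l, 0 < l <= 1 /\ forall t, Cmod (f (cone w r l t) - f w)%C <= e).
  (* The entries give l <= 1, |h| < d and (e + |L|) |h| <= e, since |h| <= 2 r l. *)
  { set (l := Rmin 1 (Rmin (d / (4 * r)) (e / (2 * r * (e + Cmod L))))).
    assert (Hlpos : 0 < l).
    { repeat apply Rmin_pos; [lra|apply Rdiv_lt_0_compat; lra|].
      apply Rdiv_lt_0_compat; [lra|]; apply Rmult_lt_0_compat; lra. }
    assert (Hl1 : l <= 1) by apply Rmin_l.
    assert (Hl2 : l <= d / (4 * r)) by (eapply Rle_trans; [apply Rmin_r|apply Rmin_l]).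
    assert (Hl3 : l <= e / (2 * r * (e + Cmod L)))
      by (eapply Rle_trans; [apply Rmin_r|apply Rmin_r]).
    exists l; split; [lra|]; intro t.
    set (h := (RtoC l * (circ r t - w))%C).
    assert (Hh : Cmod h <= l * (2 * r)).
    { unfold h; rewrite Cmod_mult, Cmod_R, Rabs_pos_eq by lra.
      apply Rmult_le_compat_l; [lra|].
      apply Rle_trans with (1 := Cmod_triangle _ _); rewrite Cmod_opp, Cmod_circ; lra. }
    assert (Hhd : Cmod h < d).
    { apply Rmult_le_compat_r with (r := 2 * r) in Hl2; [|lra].
      replace (d / (4 * r) * (2 * r)) with (d / 2) in Hl2 by (field; lra); lra. }
    specialize (HL' h); rewrite !Cnorm_Cmod in HL'; specialize (HL' Hhd).
    change (Cmod (f (w + h) - f w - L * h)%C <= e * Cmod h) in HL'.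
    change (cone w r l t) with (w + h)%C.
    replace (f (w + h) - f w)%C with (f (w + h) - f w - L * h + L * h)%C by ring.
    apply Rle_trans with (1 := Cmod_triangle _ _); rewrite Cmod_mult.
    apply Rmult_le_compat_r with (r := 2 * r * (e + Cmod L)) in Hl3;
      [|apply Rmult_le_pos; lra].
    replace (e / (2 * r * (e + Cmod L)) * (2 * r * (e + Cmod L))) with e in Hl3
      by (field; lra).
    apply Rmult_le_compat_r with (r := e + Cmod L) in Hh; lra. }
  destruct Hsmall as [l [Hl Hfl]].
  unfold I; rewrite <- (circle_deformation G w r l 1); [|lra|lra|intros; apply HG; lra].
  assert (J := is_RInt_circle_pint G w r l 0 (2 * PI) ltac:(lra)
    (fun t _ => HG l t Hl)).
  replace (2 * PI * (r / (r - Cmod w)) * e)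
    with (e * (r / (r - Cmod w)) * (2 * PI - 0)) by ring.
  refine (Cmod_RInt_le _ 0 (2 * PI) _ _ _ _
    (is_RInt_minus (V := C_R_NormedModule) _ _ _ _ _ _ J JK)); [lra|].
  intros t _; unfold G.
  change (Cmod (f (cone w r l t) / (cone w r l t - w) * (RtoC l * (Ci * circ r t))
    - f w * Ci * (circ r t / (circ r t - w)))%C <= e * (r / (r - Cmod w))).
  rewrite Hsub.
  replace (f (cone w r l t) / (RtoC l * (circ r t - w)) * (RtoC l * (Ci * circ r t))
    - f w * Ci * (circ r t / (circ r t - w)))%C
    with ((f (cone w r l t) - f w) * (Ci * (circ r t / (circ r t - w))))%C
    by (field; split; [apply Hne0|apply Hl0; lra]).
  rewrite !Cmod_mult, Cmod_Ci, Rmult_1_l, Cmod_div, Cmod_circ by (apply Hne0 || lra).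
  apply Rmult_le_compat; [apply Cmod_ge_0| |apply Hfl|].
  - apply Rmult_le_pos; [lra|left; apply Rinv_0_lt_compat; generalize (Hne t); lra].
  - apply Rmult_le_compat_l; [lra|apply Rinv_le_contravar; [lra|apply Hne]]. }
assert (J := is_RInt_circle_pint G w r 1 0 (2 * PI) ltac:(lra)
  (fun t _ => HG 1 t ltac:(lra))).
apply (is_RInt_Cmult_l (/ Ci)) in J; fold I in J; rewrite HI in J.
replace (RtoC (2 * PI) * f w)%C with (/ Ci * (f w * Ci * RtoC (2 * PI)))%C
  by (field; apply Ci_neq_0).
revert J; apply is_RInt_Cext; intros t; unfold G.
rewrite Hsub; replace (cone w r 1 t) with (circ r t) by (unfold cone; ring).
field; repeat split; apply Ci_neq_0 || apply Hne0.
Qed.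

Lemma bounded_on_circle f r : 0 <= r -> (forall z, Cmod z <= r -> hol_at f z) ->
  exists M, 0 < M /\ forall t, 0 <= t <= 2 * PI -> Cmod (f (circ r t)) <= M.
Proof.
intros Hr Hf.
destruct (bounded_continuity (V := C_R_NormedModule) (fun t => f (circ r t)) 0 (2 * PI))
  as [M HM].
{ intros t _; destruct (Hf (circ r t)) as [l Hl]; [rewrite Cmod_circ; lra|].
  exact (continuous_cderiv f (circ r) t l Hl (circ_continuous r t)). }
exists M; split.
- apply Rle_lt_trans with (2 := HM 0 ltac:(generalize PI_RGT_0; lra)); apply norm_ge_0.
- intros t Ht; left; rewrite <- norm_Cmod; auto.
Qed.

(** The integral is compared with the difference quotient of [f] for a real increment [s]: expanding
    1 / (z - w - s) to first order leaves the remainder s^2 / ((z - w - s)(z - w)^2) in the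
    kernel. *)
Lemma cauchy_formula_deriv f f' w r : Cmod w < r ->
  (forall z, Cmod z <= r -> hol_at f z) -> is_cderiv f w f' ->
  is_RInt (fun t => (f (circ r t) * (circ r t / ((circ r t - w) * (circ r t - w))))%C)
    0 (2 * PI) (RtoC (2 * PI) * f')%C.
Proof.
intros Hw Hf Hd; assert (Hw0 := Cmod_ge_0 w); assert (HPI := PI_RGT_0).
assert (Hr : 0 < r) by lra.
destruct (bounded_on_circle f r ltac:(lra) Hf) as [M [HM HfM]].
assert (Hne : forall v t, r - Cmod v <= Cmod (circ r t - v)%C).
{ intros v t; eapply Rle_trans; [|apply Cmod_sub_ge]; rewrite Cmod_circ; lra. }
assert (Hne0 : forall v t, Cmod v < r -> (circ r t - v)%C <> 0%C).
{ intros v t Hv; apply Cmod_gt_0; generalize (Hne v t); lra. }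
set (F := fun t => (f (circ r t) * (circ r t / ((circ r t - w) * (circ r t - w))))%C).
assert (HF : ex_RInt (V := C_R_CompleteNormedModule) F 0 (2 * PI)).
{ apply ex_RInt_continuous; intros t _.
  (* Differentiability of f(z) / (z - w)^2 on the circle yields the continuity of the integrand,
     hence its integrability. *)
  assert (HG : hol_at (fun z => f z / (z - w) / (z - w))%C (circ r t)).
  { assert (circ r t <> w).
    { intro E; apply (Hne0 w t Hw); rewrite E; ring. }
    apply (hol_at_cauchy_kernel (fun z => f z / (z - w))%C); [|assumption].
    apply hol_at_cauchy_kernel; [|assumption].
    apply Hf; rewrite Cmod_circ; lra. }
  destruct HG as [l Hl].
  apply (continuous_ext (fun t => (f (circ r t) / (circ r t - w) / (circ r t - w)) * circ r t)%C).
  - intro s; unfold F; simpl; field; apply Hne0; exact Hw.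
  - apply continuous_Cmult; [|apply circ_continuous].
    exact (continuous_cderiv _ (circ r) t l Hl (circ_continuous r t)). }
apply RInt_correct in HF; set (D := RInt (V := C_R_CompleteNormedModule) F 0 (2 * PI)) in HF.
enough (E : D = (RtoC (2 * PI) * f')%C) by (rewrite <- E; exact HF).
set (g := r - Cmod w); assert (Hg : 0 < g) by (unfold g; lra).
(* On the circle |f| <= M, |z| = r and |z - w| >= g, while |z - w - s| >= g / 2 because s <= e <= g
   / 2. *)
set (K := M * (r / (g / 2 * (g * g))) * (2 * PI)).
apply Ceq_of_small with (K + 2 * PI) (g / 2); [lra|].
intros e He.
destruct (Hd e ltac:(lra)) as [d [Hdp Hd']].
set (s := Rmin e (d / 2)).
assert (Hs : 0 < s) by (apply Rmin_pos; lra).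
assert (Hse : s <= e) by apply Rmin_l.
assert (Hsd : s <= d / 2) by apply Rmin_r.
assert (Hsm : Cmod (RtoC s) = s) by (rewrite Cmod_R, Rabs_pos_eq; lra).
specialize (Hd' (RtoC s)); rewrite !Cnorm_Cmod, Hsm in Hd'; specialize (Hd' ltac:(lra)).
change (Cmod (f (w + RtoC s) - f w - f' * RtoC s)%C <= e * s) in Hd'.
assert (Hws : Cmod (w + RtoC s)%C <= Cmod w + s) by (rewrite <- Hsm at 2; apply Cmod_triangle).
assert (Hws2 : Cmod (w + RtoC s)%C < r) by (unfold g in He; lra).
assert (J1 := cauchy_formula f (w + RtoC s)%C r Hws2 Hf).
assert (J0 := cauchy_formula f w r Hw Hf).
assert (JD := is_RInt_Cmult_l (RtoC s) _ _ _ _ HF).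
assert (J := is_RInt_minus (V := C_R_NormedModule) _ _ _ _ _ _
  (is_RInt_minus (V := C_R_NormedModule) _ _ _ _ _ _ J1 J0) JD).
assert (B : Cmod (RtoC (2 * PI) * f (w + RtoC s) - RtoC (2 * PI) * f w - RtoC s * D)%C
  <= K * s * s).
{ replace (K * s * s) with (M * (r / (g / 2 * (g * g))) * (s * s) * (2 * PI - 0))
    by (unfold K; ring).
  refine (Cmod_RInt_le _ 0 (2 * PI) _ _ _ _ J); [lra|].
  intros t Ht; unfold F.
  set (z := circ r t).
  assert (N0 := Hne0 w t Hw); assert (N1 := Hne0 (w + RtoC s)%C t Hws2); fold z in N0, N1.
  change (Cmod (f z * (z / (z - (w + RtoC s))) - f z * (z / (z - w))
    - RtoC s * (f z * (z / ((z - w) * (z - w)))))%C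
    <= M * (r / (g / 2 * (g * g))) * (s * s)).
  replace (f z * (z / (z - (w + RtoC s))) - f z * (z / (z - w))
    - RtoC s * (f z * (z / ((z - w) * (z - w)))))%C
    with (f z * (z / ((z - (w + RtoC s)) * ((z - w) * (z - w)))) * (RtoC s * RtoC s))%C
    by (field; split; [exact N0|]; intro E; apply N1; rewrite <- E; ring).
  rewrite !Cmod_mult, Hsm.
  apply Rmult_le_compat_r; [apply Rle_0_sqr|].
  apply Rmult_le_compat; [apply Cmod_ge_0|apply Cmod_ge_0|apply HfM, Ht|].
  rewrite Cmod_div by (apply Cmult_neq_0; [exact N1|now apply Cmult_neq_0]).
  unfold z at 1; rewrite Cmod_circ by lra.
  apply Rmult_le_compat_l; [lra|].
  rewrite !Cmod_mult.
  apply Rinv_le_contravar.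
  - repeat apply Rmult_lt_0_compat; lra.
  - apply Rmult_le_compat; [lra|apply Rmult_le_pos; lra| |].
    + apply Rle_trans with (2 := Hne _ _); unfold g in *; lra.
    + apply Rmult_le_compat; try lra; apply Hne. }
replace (D - RtoC (2 * PI) * f')%C with
  ((- (RtoC (2 * PI) * f (w + RtoC s) - RtoC (2 * PI) * f w - RtoC s * D)
   + RtoC (2 * PI) * (f (w + RtoC s) - f w - f' * RtoC s)) / RtoC s)%C.
2:{ field; intro E; apply (f_equal fst) in E; simpl in E; lra. }
rewrite Cmod_div, Hsm by (intro E; apply (f_equal fst) in E; simpl in E; lra).
apply Rmult_le_reg_r with s; [exact Hs|].
unfold Rdiv; rewrite Rmult_assoc, Rinv_l, Rmult_1_r by lra.
apply Rle_trans with (1 := Cmod_triangle _ _).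
rewrite Cmod_opp, Cmod_mult, Cmod_R, Rabs_pos_eq by lra.
apply Rmult_le_compat_l with (r := 2 * PI) in Hd'; [|lra].
assert (HK : 0 <= K).
{ unfold K, Rdiv; apply Rmult_le_pos; [apply Rmult_le_pos; [lra|]|lra].
  apply Rmult_le_pos; [lra|left; apply Rinv_0_lt_compat].
  apply Rmult_lt_0_compat; [lra|apply Rmult_lt_0_compat; lra]. }
generalize (Rmult_le_compat_l (K * s) s e (Rmult_le_pos _ _ HK (Rlt_le _ _ Hs)) Hse).
lra.
Qed.

(** * The remainder *)

(** [beta k] is half a zero of y_n, which absorbs the division in z / 2; [n] distinct zeros are all
    of them. *)
Definition bessel_zeros (n : nat) (beta : nat -> C) : Prop :=
  (forall k, (1 <= k <= n)%nat ->
     Csum0 (fun i => RtoC (bessel_coef n i) * Cpow (beta k) i)%C n = RtoC 0) /\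
  (forall j k, (1 <= j <= n)%nat -> (1 <= k <= n)%nat -> j <> k -> beta j <> beta k).

Lemma bessel_zero_sum n beta k : bessel_zeros n beta -> (1 <= k <= n)%nat ->
  Csum1 (fun j => RtoC 2 * beta j / (beta j - beta k))%C n
  = (RtoC (INR (2 * n)) + / beta k)%C.
Proof.
intros [H1 H2] Hk.
apply BesselAlgebra.zero_sum.
- intros i Hi; apply H1; now destruct (BesselAlgebra.index_rangeP i n).
- intros i j Hi Hj; apply H2;
    [now destruct (BesselAlgebra.index_rangeP i n)|now destruct (BesselAlgebra.index_rangeP j n)].
- now destruct (BesselAlgebra.index_rangeP k n).
Qed.

Lemma bessel_kernel n beta t : bessel_zeros n beta ->
  (forall k, (1 <= k <= n)%nat -> (1 - (beta k * beta k) * (t * t))%C <> RtoC 0) ->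
  (1 + Csum1 (fun k => RtoC 2 * beta k / (1 - (beta k * beta k) * (t * t))) n
   = Cpow (- (1)) n * Cpow t (2 * n) / (Cpow (RtoC (bessel_coef n n)) 2
      * BesselAlgebra.Cprod1 (fun k => 1 - (beta k * beta k) * (t * t)) n))%C.
Proof.
intros [H1 H2] Ht.
apply BesselAlgebra.kernel.
- intros i Hi; apply H1; now destruct (BesselAlgebra.index_rangeP i n).
- intros i j Hi Hj; apply H2;
    [now destruct (BesselAlgebra.index_rangeP i n)|now destruct (BesselAlgebra.index_rangeP j n)].
- intros i Hi; apply Ht; now destruct (BesselAlgebra.index_rangeP i n).
Qed.

(** * Location of the zeros *)

Lemma exists_max (F : nat -> R) n : (1 <= n)%nat ->
  exists m, (1 <= m <= n)%nat /\ forall k, (1 <= k <= n)%nat -> F k <= F m.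
Proof.
induction n as [|n IH]; [lia|intros _].
destruct (Nat.eq_dec n 0) as [->|Hn].
- exists 1%nat; split; [lia|]; intros k Hk; replace k with 1%nat by lia; lra.
- destruct IH as [m [Hm HF]]; [lia|].
  destruct (Rle_dec (F m) (F (S n))) as [L|L].
  + exists (S n); split; [lia|]; intros k Hk.
    destruct (Nat.eq_dec k (S n)) as [->|Hk']; [lra|].
    apply Rle_trans with (2 := L), HF; lia.
  + exists m; split; [lia|]; intros k Hk.
    destruct (Nat.eq_dec k (S n)) as [->|Hk']; [lra|apply HF; lia].
Qed.

(** In the induction a partial sum may stop before [m]; the conditional subtracts 1 only once the
    vanishing summand has been counted. *)
Lemma Re_Csum1_le (F : nat -> C) m n :
  (forall k, (1 <= k <= n)%nat -> k <> m -> fst (F k) <= 1) -> fst (F m) = 0 ->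
  (1 <= m)%nat ->
  fst (Csum1 F n) <= INR n - (if le_dec m n then 1 else 0).
Proof.
intros HF Hm Hm1; induction n as [|n IH].
- simpl; destruct (le_dec m 0); [lia|lra].
- rewrite S_INR; simpl (Csum1 _ _); simpl (fst (Cadd _ _)).
  assert (IH' := IH (fun k Hk => HF k ltac:(lia))).
  destruct (Nat.eq_dec (S n) m) as [E|E].
  + rewrite E, Hm; destruct (le_dec m n); [lia|]; destruct (le_dec m m); [lra|lia].
  + assert (H := HF (S n) ltac:(lia) E).
    destruct (le_dec m n); destruct (le_dec m (S n)); lra || lia.
Qed.

(** 2 a / (a - b) = 1 + (a + b) / (a - b), and the last quotient has real part (|a|^2 - |b|^2) / |a
    - b|^2. *)
Lemma Re_quotient_le (a b : C) : a <> b -> Cmod a <= Cmod b ->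
  fst (RtoC 2 * a / (a - b))%C <= 1.
Proof.
intros Hab Hle; destruct a as [a1 a2], b as [b1 b2].
unfold Cmod in Hle; simpl in Hle; apply sqrt_le_0 in Hle; try nra.
assert (HD : 0 < (a1 - b1) * (a1 - b1) + (a2 - b2) * (a2 - b2)).
{ destruct (Req_dec a1 b1) as [E1|E1]; [destruct (Req_dec a2 b2) as [E2|E2]|].
  - exfalso; apply Hab; congruence.
  - apply Rplus_le_lt_0_compat; [apply Rle_0_sqr|]; apply Rsqr_pos_lt; lra.
  - apply Rplus_lt_le_0_compat; [|apply Rle_0_sqr]; apply Rsqr_pos_lt; lra. }
simpl.
replace (_ - _) with ((2 * a1 * (a1 - b1) + 2 * a2 * (a2 - b2))
   / ((a1 - b1) * (a1 - b1) + (a2 - b2) * (a2 - b2))) by (field; lra).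
apply Rmult_le_reg_r with (1 := HD).
unfold Rdiv; rewrite Rmult_assoc, Rinv_l by lra; nra.
Qed.

(* The bound is proved at a zero [b] of maximal modulus, where all the summands
   of [bessel_zero_sum] have real part at most 1; hence Re (1 / b) <= - (n + 1). *)
Lemma bessel_zero_bound n beta k : bessel_zeros n beta -> (1 <= k <= n)%nat ->
  Cmod (beta k) <= / (INR n + 1).
Proof.
intros Hz Hk.
destruct (exists_max (fun i => Cmod (beta i)) n ltac:(lia)) as [m [Hm HF]].
apply Rle_trans with (1 := HF k Hk).
assert (E := bessel_zero_sum n beta m Hz Hm); apply (f_equal fst) in E.
assert (Hn := pos_INR n).
assert (HR := Re_Csum1_le (fun j => RtoC 2 * beta j / (beta j - beta m))%C m n).
lapply HR; clear HR; [intro HR|].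
2:{ intros j Hj Hjm; apply Re_quotient_le; [|now apply HF].
    apply (proj2 Hz); assumption. }
lapply HR; clear HR; [intro HR|].
(* The summand [m] has denominator 0; both coordinates of [Cinv] at 0 are 0. *)
2:{ replace (beta m - beta m)%C with (RtoC 0) by ring.
    simpl; unfold Rdiv; ring. }
specialize (HR ltac:(lia)); rewrite E in HR.
destruct (le_dec m n) as [_|]; [|lia].
rewrite mult_INR in HR; simpl (INR 2) in HR; simpl (fst (_ + _)%C) in HR.
destruct (Req_dec (Cmod (beta m)) 0) as [H0|H0].
{ rewrite H0; left; apply Rinv_0_lt_compat; lra. }
assert (Hb : beta m <> 0%C) by (intro B; apply H0; rewrite B; apply Cmod_0).
(* For b = [beta m], [HR] says 2 n + Re (1 / b) <= n - 1, so 1 / |b| >= - Re (1 / b) >= n + 1. *)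
assert (Hre : - fst (/ beta m)%C <= Cmod (/ beta m)%C).
{ eapply Rle_trans; [|apply Rmax_Cmod]; eapply Rle_trans; [|apply Rmax_l].
  rewrite <- Rabs_Ropp; apply RRle_abs. }
rewrite Cmod_inv in Hre by exact Hb.
assert (Hpos : 0 < Cmod (beta m)) by (apply Cmod_gt_0; exact Hb).
rewrite <- (Rinv_inv (Cmod (beta m))).
apply Rinv_le_contravar; [lra|].
change (INR (n + (n + 0))) with (INR (2 * n)) in HR; simpl in HR, Hre; lra.
Qed.

(** * The kernel of the remainder and its bound *)

Lemma Csum1_ext (F G : nat -> C) n :
  (forall k, (1 <= k <= n)%nat -> F k = G k) -> Csum1 F n = Csum1 G n.
Proof.
intro H; induction n as [|n IH]; [reflexivity|]; simpl.
rewrite IH, H; [reflexivity|lia|intros; apply H; lia].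
Qed.

Lemma Csum1_mult_l (c : C) (F : nat -> C) n :
  (c * Csum1 F n)%C = Csum1 (fun k => c * F k)%C n.
Proof.
induction n as [|n IH]; [change ((c * RtoC 0)%C = RtoC 0); ring|].
change ((c * (Csum1 F n + F (S n)))%C = (Csum1 (fun k => c * F k) n + c * F (S n))%C).
rewrite <- IH; ring.
Qed.

Lemma is_RInt_Csum1 (F : nat -> R -> C) (L : nat -> C) a b n :
  (forall k, (1 <= k <= n)%nat -> is_RInt (F k) a b (L k)) ->
  is_RInt (fun t => Csum1 (fun k => F k t) n) a b (Csum1 L n).
Proof.
intro H; induction n as [|n IH].
- generalize (is_RInt_Cconst (RtoC 0) a b); rewrite Cmult_0_r; trivial.
- simpl; apply (is_RInt_plus (V := C_R_NormedModule)); [apply IH; intros; apply H|apply H]; lia.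
Qed.

Lemma Cmod_pow_n (z : C) k : Cmod (Cpow z k) = Cmod z ^ k.
Proof.
induction k as [|k IH]; [exact Cmod_1|].
change (Cmod (z * Cpow z k)%C = Cmod z ^ S k); now rewrite Cmod_mult, IH.
Qed.

Lemma Cmod_prod_ge (F : nat -> C) q n : 0 <= q ->
  (forall k, (1 <= k <= n)%nat -> q <= Cmod (F k)) -> q ^ n <= Cmod (BesselAlgebra.Cprod1 F n).
Proof.
intros Hq H; induction n as [|n IH]; [simpl; rewrite Cmod_1; lra|].
simpl; rewrite Cmod_mult, Rmult_comm.
apply Rmult_le_compat; [now apply pow_le|exact Hq|apply IH; intros; apply H; lia|apply H; lia].
Qed.

(** For n >= 1 the base is 1 / (1 + 1 / n), and (1 + 1 / n)^n <= e <= 3. *)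
Lemma pow_one_minus_inv_ge n : / 3 <= (1 - / (INR n + 1)) ^ n.
Proof.
destruct (Nat.eq_dec n 0) as [->|Hn]; [simpl; lra|].
assert (Hp : 0 < INR n) by (apply lt_0_INR; lia).
replace (1 - / (INR n + 1)) with (/ (1 + / INR n)) by (field; lra).
rewrite pow_inv; apply Rinv_le_contravar.
- apply pow_lt; generalize (Rinv_0_lt_compat _ Hp); lra.
- apply Rle_trans with (2 := exp_le_3).
  replace (exp 1) with (exp (/ INR n) ^ n).
  + apply pow_incr; split; [generalize (Rinv_0_lt_compat _ Hp); lra|].
    left; apply exp_ineq1; generalize (Rinv_0_lt_compat _ Hp); lra.
  + assert (E : forall m, exp (/ INR n) ^ m = exp (INR m * / INR n)).
    { induction m as [|m IH]; [simpl; now rewrite Rmult_0_l, exp_0|].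
      rewrite S_INR; simpl; rewrite IH, <- exp_plus; f_equal; ring. }
    rewrite E; f_equal; field; lra.
Qed.

(** Here [z] is the point on the circle and [w] the argument: under the modulus stands the operator
    of [r_n] applied to w -> z / (z - w). With t = w / (z - w) it equals t z / (z - w) times the
    bracket evaluated by [bessel_kernel]; the 3 comes from the lower bound 1 / 3 of the product. *)
Lemma bessel_kernel_bound n beta z w : bessel_zeros n beta ->
  (z - w)%C <> 0%C -> Cmod (w / (z - w))%C ^ 2 <= INR n + 1 ->
  (1 <= n)%nat ->
  Cmod (w * (z / ((z - w) * (z - w)))
    - Csum1 (fun k => z / (z - (1 - beta k) * w) - z / (z - (1 + beta k) * w)) n)%C
  <= 3 * Cmod (z / (z - w))%C * Cmod (w / (z - w))%C ^ (2 * n + 1) / bessel_coef n n ^ 2.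
Proof.
intros Hz Hzw Ht Hn.
assert (HN : 1 < INR n + 1) by (generalize (lt_0_INR n ltac:(lia)); lra).
set (t := (w / (z - w))%C) in *.
assert (Hw : w = (t * (z - w))%C) by (unfold t; field; exact Hzw).
(* |beta_k|^2 |t|^2 is at most (n + 1)^-2 times n + 1. *)
assert (Hbt : forall k, (1 <= k <= n)%nat -> Cmod (beta k * beta k * (t * t))%C <= / (INR n + 1)).
{ intros k Hk; assert (B := bessel_zero_bound n beta k Hz Hk); assert (B0 := Cmod_ge_0 (beta k)).
  rewrite !Cmod_mult.
  replace (/ (INR n + 1)) with (/ (INR n + 1) * / (INR n + 1) * (INR n + 1)) by (field; lra).
  apply Rmult_le_compat.
  - apply Rmult_le_pos; exact B0.
  - apply Rmult_le_pos; apply Cmod_ge_0.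
  - apply Rmult_le_compat; assumption.
  - simpl in Ht; rewrite Rmult_1_r in Ht; exact Ht. }
assert (Hq : forall k, (1 <= k <= n)%nat ->
  1 - / (INR n + 1) <= Cmod (1 - beta k * beta k * (t * t))%C).
{ intros k Hk; eapply Rle_trans; [|apply Cmod_sub_ge]; rewrite Cmod_1.
  generalize (Hbt k Hk); lra. }
assert (Hq0 : 0 < 1 - / (INR n + 1)).
{ assert (/ (INR n + 1) < 1); [|lra].
  rewrite <- Rinv_1; apply Rinv_lt_contravar; lra. }
assert (Hne : forall k, (1 <= k <= n)%nat -> (1 - (beta k * beta k) * (t * t))%C <> RtoC 0).
{ intros k Hk; apply Cmod_gt_0; generalize (Hq k Hk); lra. }
assert (HK := bessel_kernel n beta t Hz Hne).
assert (E : (w * (z / ((z - w) * (z - w)))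
    - Csum1 (fun k => z / (z - (1 - beta k) * w) - z / (z - (1 + beta k) * w)) n
  = z / (z - w) * t
    * (1 + Csum1 (fun k => RtoC 2 * beta k / (1 - beta k * beta k * (t * t))) n))%C).
{ rewrite Cmult_plus_distr_l, Csum1_mult_l.
  rewrite (Csum1_ext (fun k => z / (z - (1 - beta k) * w) - z / (z - (1 + beta k) * w))%C
    (fun k => - (1) * (z / (z - w) * t * (RtoC 2 * beta k / (1 - beta k * beta k * (t * t)))))%C).
  - rewrite <- Csum1_mult_l; unfold t; field; exact Hzw.
  - intros k Hk.
    (* With z - (1 - beta_k) w = (z - w)(1 + beta_k t) and its counterpart for the other sign, the
       pair of index [k] combines over the denominator 1 - beta_k^2 t^2. *)
    assert (F : (1 - beta k * beta k * (t * t) = (1 + beta k * t) * (1 - beta k * t))%C) by ring.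
    assert (N := Hne k Hk); rewrite F in N.
    assert (N1 : (1 + beta k * t)%C <> 0%C) by (intro A; apply N; rewrite A; ring).
    assert (N2 : (1 - beta k * t)%C <> 0%C) by (intro A; apply N; rewrite A; ring).
    rewrite F.
    replace (z - (1 - beta k) * w)%C with ((z - w) * (1 + beta k * t))%C
      by (unfold t; field; exact Hzw).
    replace (z - (1 + beta k) * w)%C with ((z - w) * (1 - beta k * t))%C
      by (unfold t; field; exact Hzw).
    field; repeat split; assumption. }
rewrite E, HK.
assert (Hd : 0 < bessel_coef n n).
{ rewrite bessel_coef_top; apply Rdiv_lt_0_compat; apply INR_fact_lt_0. }
set (P := BesselAlgebra.Cprod1 _ n).
assert (HP : / 3 <= Cmod P).
{ apply Rle_trans with (1 := pow_one_minus_inv_ge n).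
  apply Cmod_prod_ge; [lra|exact Hq]. }
assert (HP0 : P <> 0%C) by (apply Cmod_gt_0; lra).
assert (Hd0 : Cmod (Cpow (RtoC (bessel_coef n n)) 2) = bessel_coef n n ^ 2)
  by (rewrite Cmod_pow_n, Cmod_R, Rabs_pos_eq; lra).
assert (Hd2 : 0 < bessel_coef n n ^ 2) by now apply pow_lt.
set (q := (z / (z - w))%C); rewrite !Cmod_mult, Cmod_div.
2:{ apply Cmult_neq_0; [apply Cmod_gt_0; lra|exact HP0]. }
rewrite !Cmod_mult, Hd0, !Cmod_pow_n, Cmod_opp, Cmod_1, pow1, pow_add, pow_1.
replace (Cmod q * Cmod t * (1 * Cmod t ^ (2 * n) / (bessel_coef n n ^ 2 * Cmod P)))
  with (/ Cmod P * (Cmod q * (Cmod t ^ (2 * n) * Cmod t) / bessel_coef n n ^ 2))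
  by (field; split; [lra|apply Rgt_not_eq; lra]).
replace (3 * Cmod q * (Cmod t ^ (2 * n) * Cmod t) / bessel_coef n n ^ 2)
  with (3 * (Cmod q * (Cmod t ^ (2 * n) * Cmod t) / bessel_coef n n ^ 2))
  by (field; apply Rgt_not_eq; exact Hd).
apply Rmult_le_compat_r.
- apply Rmult_le_pos; [|left; now apply Rinv_0_lt_compat].
  repeat apply Rmult_le_pos; try apply Cmod_ge_0; apply pow_le, Cmod_ge_0.
- rewrite <- (Rinv_inv 3); apply Rinv_le_contravar; lra.
Qed.

(** * Integral representation and estimate of the remainder *)

(** A linear combination of Cauchy's formulas for f'(z) and for [f] at the points a_k z and b_k z,
    all inside the circle. *)
Lemma r_n_integral f f' alpha n z r :
  (forall v, Cmod v <= r -> is_cderiv f v (f' v)) -> Cmod z < r ->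
  (forall k, (1 <= k <= n)%nat -> Cmod (bessel_a (alpha k) * z)%C < r /\
     Cmod (bessel_b (alpha k) * z)%C < r) ->
  is_RInt (fun t => (f (circ r t) * (z * (circ r t / ((circ r t - z) * (circ r t - z)))
    - Csum1 (fun k => circ r t / (circ r t - bessel_a (alpha k) * z)
                    - circ r t / (circ r t - bessel_b (alpha k) * z)) n))%C) 0 (2 * PI)
    (RtoC (2 * PI) * r_n f f' alpha n z)%C.
Proof.
intros Hf Hz Hab.
assert (Hh : forall v, Cmod v <= r -> hol_at f v) by (intros v Hv; exists (f' v); auto).
assert (J1 := is_RInt_Cmult_l z _ _ _ _
  (cauchy_formula_deriv f (f' z) z r Hz Hh (Hf z (Rlt_le _ _ Hz)))).
assert (J2 : is_RInt (fun t => Csum1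
     (fun k => (f (circ r t) * (circ r t / (circ r t - bessel_a (alpha k) * z))
              - f (circ r t) * (circ r t / (circ r t - bessel_b (alpha k) * z)))%C) n) 0 (2 * PI)
   (Csum1 (fun k => RtoC (2 * PI) * f (bessel_a (alpha k) * z)
       - RtoC (2 * PI) * f (bessel_b (alpha k) * z)) n)%C).
{ apply (is_RInt_Csum1
    (fun k t => (f (circ r t) * (circ r t / (circ r t - bessel_a (alpha k) * z))
               - f (circ r t) * (circ r t / (circ r t - bessel_b (alpha k) * z)))%C)).
  intros k Hk; destruct (Hab k Hk) as [Ha Hb].
  apply (is_RInt_minus (V := C_R_NormedModule)); apply cauchy_formula; assumption. }
assert (J := is_RInt_minus (V := C_R_NormedModule) _ _ _ _ _ _ J1 J2).
match type of J with is_RInt _ _ _ ?l => replace (RtoC (2 * PI) * r_n f f' alpha n z)%C with l end.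
- revert J; apply is_RInt_Cext; intro t.
  set (c := circ r t); set (F := f c).
  match goal with |- minus ?x (Csum1 ?G n) = ?y => change ((x - Csum1 G n)%C = y) end.
  rewrite (Csum1_ext _ (fun k => F * (c / (c - bessel_a (alpha k) * z)
     - c / (c - bessel_b (alpha k) * z)))%C) by (intros; ring).
  rewrite <- Csum1_mult_l; ring.
- match goal with |- minus ?x (Csum1 ?G n) = ?y => change ((x - Csum1 G n)%C = y) end.
  rewrite (Csum1_ext _ (fun k => RtoC (2 * PI) * (f (bessel_a (alpha k) * z)
     - f (bessel_b (alpha k) * z)))%C) by (intros; ring).
  rewrite <- Csum1_mult_l.
  change (r_n f f' alpha n z) with (z * f' z - Csum1 (fun k => f (bessel_a (alpha k) * z)
     - f (bessel_b (alpha k) * z)) n)%C.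
  ring.
Qed.

(** On the circle |z / (c - z)| <= |z| / (r - |z|) <= B, and [bessel_kernel_bound] is integrated
    against |f| <= M. The hypothesis with 1 + 1 / (n + 1) places a_k z and b_k z inside the circle,
    as |beta_k| <= 1 / (n + 1). *)
Lemma r_n_bound f f' alpha n z r M B :
  (forall v, Cmod v <= r -> is_cderiv f v (f' v)) -> Cmod z < r -> (1 <= n)%nat ->
  (forall k, (1 <= k <= n)%nat -> bessel_y n (alpha k) = C0) ->
  (forall j k, (1 <= j <= n)%nat -> (1 <= k <= n)%nat -> j <> k -> alpha j <> alpha k) ->
  (1 + / (INR n + 1)) * Cmod z < r ->
  (forall t, 0 <= t <= 2 * PI -> Cmod (f (circ r t)) <= M) ->
  0 <= B -> B ^ 2 <= INR n + 1 -> Cmod z <= B * (r - Cmod z) ->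
  Cmod (r_n f f' alpha n z)
  <= M * (3 * (r / (r - Cmod z)) * B ^ (2 * n + 1) / bessel_coef n n ^ 2).
Proof.
intros Hf Hz Hn Hy Hinj Hab HM HB HB2 HzB.
assert (Hz0 := Cmod_ge_0 z); assert (HPI := PI_RGT_0).
assert (Hr : 0 < r) by lra.
set (beta := fun k => (RtoC (/ 2) * alpha k)%C).
assert (Hzeros : bessel_zeros n beta).
{ split; [exact Hy|].
  intros j k Hj Hk Hjk E; apply (Hinj j k Hj Hk Hjk).
  apply (f_equal (fun x => RtoC 2 * x)%C) in E; unfold beta in E.
  rewrite !Cmult_assoc, <- !RtoC_mult in E.
  replace (2 * / 2) with 1 in E by field; now rewrite !Cmult_1_l in E. }
assert (Hbeta := bessel_zero_bound n beta).
assert (Hd : 0 < bessel_coef n n).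
{ rewrite bessel_coef_top; apply Rdiv_lt_0_compat; apply INR_fact_lt_0. }
assert (J := r_n_integral f f' alpha n z r Hf Hz).
lapply J; clear J; [intro J|].
2:{ intros k Hk; specialize (Hbeta k Hzeros Hk).
  change (bessel_a (alpha k)) with (1 - beta k)%C.
  change (bessel_b (alpha k)) with (1 + beta k)%C.
  rewrite !Cmod_mult; split; apply Rle_lt_trans with (2 := Hab);
    (apply Rmult_le_compat_r; [exact Hz0|]);
    apply Rle_trans with (1 := Cmod_triangle _ _); rewrite ?Cmod_opp, Cmod_1; lra. }
set (K := M * _).
assert (Hint : Cmod (RtoC (2 * PI) * r_n f f' alpha n z)%C <= K * (2 * PI - 0)).
{ apply (Cmod_RInt_le _ 0 (2 * PI) _ K ltac:(lra)) with (2 := J).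
  intros t Ht; rewrite Cmod_mult; unfold K.
  set (c := circ r t).
  assert (Hc : Cmod c = r) by (apply Cmod_circ; lra).
  assert (Hcz : r - Cmod z <= Cmod (c - z)%C) by (rewrite <- Hc; apply Cmod_sub_ge).
  assert (Hcz0 : (c - z)%C <> 0%C) by (apply Cmod_gt_0; lra).
  apply Rmult_le_compat; try apply Cmod_ge_0; [now apply HM|].
  assert (Hu : Cmod (z / (c - z))%C <= B).
  { rewrite Cmod_div by exact Hcz0.
    apply Rmult_le_reg_r with (Cmod (c - z)%C); [lra|].
    unfold Rdiv; rewrite Rmult_assoc, Rinv_l, Rmult_1_r by lra.
    apply Rle_trans with (1 := HzB); apply Rmult_le_compat_l; assumption. }
  assert (Hu0 := Cmod_ge_0 (z / (c - z))%C).
  eapply Rle_trans; [apply (bessel_kernel_bound n beta c z Hzeros Hcz0); [|exact Hn]|].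
  - apply Rle_trans with (2 := HB2); apply pow_incr; lra.
  - apply Rmult_le_compat_r; [left; now apply Rinv_0_lt_compat, pow_lt|].
    apply Rmult_le_compat.
    + apply Rmult_le_pos; [lra|apply Cmod_ge_0].
    + apply pow_le; lra.
    + apply Rmult_le_compat_l; [lra|].
      rewrite Cmod_div, Hc by exact Hcz0.
      apply Rmult_le_compat_l; [lra|apply Rinv_le_contravar; lra].
    + apply pow_incr; lra. }
rewrite Cmod_mult, Cmod_R, Rabs_pos_eq in Hint by lra.
apply Rmult_le_reg_l with (2 * PI); lra.
Qed.

Theorem theorem2 :
  forall (f f' : Cx -> Cx),
    (forall z : Cx, in_disk z -> is_cderiv f z (f' z)) ->
  forall eps : R, 0 < eps < 1 ->
  exists Cst : R, 0 < Cst /\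
    forall (x : R) (n : nat) (alpha : nat -> Cx) (z : Cx),
      0 < x < 1 ->
      (1 <= n)%nat ->
      n0 x <= INR n ->
      (* alpha 1, ..., alpha n are the (simple) zeros of y_n *)
      (forall k, (1 <= k <= n)%nat -> bessel_y n (alpha k) = C0) ->
      (forall j k, (1 <= j <= n)%nat -> (1 <= k <= n)%nat -> j <> k ->
         alpha j <> alpha k) ->
      Cnorm z <= (1 - eps) * x ->
      Cnorm (r_n f f' alpha n z) <=
        Cst * ((1 - eps / 2) ^ (2 * n) * x ^ (2 * n + 1) / (1 - x) ^ (2 * n + 2))
            * (INR (fact n) ^ 2 / INR (fact (2 * n)) ^ 2).
Proof.
intros f f' Hf eps Heps.
(* This circle lies inside the disk and depends on [eps] only; since r (1 - eps / 2) = 1 - eps, a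
   factor 1 - eps / 2 is left between |z| and r x. *)
set (r := (1 - eps) / (1 - eps / 2)).
assert (Hre : r * (1 - eps / 2) = 1 - eps) by (unfold r; field; lra).
assert (Hr0 : 0 < r) by (apply Rdiv_lt_0_compat; lra).
assert (Hr1 : r < 1).
{ apply Rmult_lt_reg_r with (1 - eps / 2); lra. }
clearbody r.
assert (Hfr : forall v, Cmod v <= r -> is_cderiv f v (f' v)).
{ intros v Hv; apply Hf; unfold in_disk; rewrite Cnorm_Cmod; lra. }
destruct (bounded_on_circle f r) as [M [HM HfM]].
{ lra. }
{ intros v Hv; exists (f' v); now apply Hfr. }
(* [M] bounds |f| on the circle, so it depends on [f] and [eps] only; the 3 is that of
   [bessel_kernel_bound]. *)
exists (3 * M); split; [lra|].
intros x n alpha z Hx Hn Hnx Hy Hinj Hz; rewrite Cnorm_Cmod in Hz |- *.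
assert (Hz0 := Cmod_ge_0 z).
set (X := x / (1 - x)).
assert (HX0 : 0 < X) by (apply Rdiv_lt_0_compat; lra).
assert (HX2 : X ^ 2 <= INR n + 1).
(* The second entry of the maximum in [n0] is X^2. *)
{ unfold n0 in Hnx.
  replace (X ^ 2) with (x ^ 2 / (1 - x) ^ 2) by (unfold X; field; lra).
  generalize (Rmax_r 14 (x ^ 2 / (1 - x) ^ 2)); lra. }
(* Equivalent to (1 + 1 / (n + 1)) x <= 1, which keeps a_k z and b_k z inside the circle. *)
assert (HXN : X <= INR n + 1).
{ generalize (lt_0_INR n ltac:(lia)); intro; nra. }
assert (HxX : x = X * (1 - x)) by (unfold X; field; lra).
assert (Hzr : Cmod z <= r * (1 - eps / 2) * x) by (rewrite Hre; exact Hz).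
assert (Hzx : Cmod z <= r * x).
{ apply Rle_trans with (1 := Hzr); apply Rmult_le_compat_r; [lra|].
  rewrite <- (Rmult_1_r r) at 2; apply Rmult_le_compat_l; lra. }
assert (Hzx' : Cmod z < r * x).
{ apply Rle_lt_trans with (1 := Hzr); apply Rmult_lt_compat_r; [lra|].
  rewrite <- (Rmult_1_r r) at 2; apply Rmult_lt_compat_l; lra. }
assert (Hgap : r * (1 - x) <= r - Cmod z) by lra.
assert (Hgap0 : 0 < r * (1 - x)) by (apply Rmult_lt_0_compat; lra).
(* From |z| <= r (1 - eps / 2) x and r - |z| >= r (1 - x), this bounds |z| / (r - |z|). *)
set (B := (1 - eps / 2) * X).
assert (HB0 : 0 <= B) by (apply Rmult_le_pos; lra).
assert (HBX : B <= X) by (unfold B; rewrite <- (Rmult_1_l X) at 2; apply Rmult_le_compat_r; lra).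
eapply Rle_trans.
{ apply (r_n_bound f f' alpha n z r M B); auto.
  - lra.
  - apply Rlt_le_trans with ((1 + / (INR n + 1)) * (r * x)).
    + apply Rmult_lt_compat_l; [|exact Hzx'].
      assert (0 < / (INR n + 1)) by (apply Rinv_0_lt_compat; lra); lra.
    + apply Rmult_le_reg_r with (INR n + 1); [lra|].
      replace ((1 + / (INR n + 1)) * (r * x) * (INR n + 1)) with (r * (x * (INR n + 1) + x))
        by (field; lra).
      apply Rmult_le_compat_l; [lra|].
      assert (HXN' := Rmult_le_compat_r (1 - x) _ _ ltac:(lra) HXN); lra.
  - apply Rle_trans with (2 := HX2); apply pow_incr; lra.
  - apply Rle_trans with (1 := Hzr).
    apply Rle_trans with (B * (r * (1 - x))).
    + unfold B, X; apply Req_le; field; lra.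
    + apply Rmult_le_compat_l; assumption. }
rewrite bessel_coef_top.
assert (F1 := INR_fact_lt_0 n); assert (F2 := INR_fact_lt_0 (2 * n)).
set (a := INR (fact n)) in *; set (b := INR (fact (2 * n))) in *.
replace (M * (3 * (r / (r - Cmod z)) * B ^ (2 * n + 1) / (b / a) ^ 2))
  with (3 * M * (r / (r - Cmod z) * B ^ (2 * n + 1)) * (a ^ 2 / b ^ 2))
  by (field; repeat split; lra).
apply Rmult_le_compat_r.
{ apply Rmult_le_pos; [apply pow_le; lra|left; apply Rinv_0_lt_compat, pow_lt; lra]. }
apply Rmult_le_compat_l; [lra|].
assert (H1x : 0 < (1 - x) ^ (2 * n + 1)) by (apply pow_lt; lra).
replace ((1 - eps / 2) ^ (2 * n) * x ^ (2 * n + 1) / (1 - x) ^ (2 * n + 2))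
  with (/ (1 - x) * ((1 - eps / 2) ^ (2 * n) * X ^ (2 * n + 1))).
2:{ unfold X, Rdiv; rewrite Rpow_mult_distr, pow_inv.
    replace (2 * n + 2)%nat with (S (2 * n + 1)) by lia.
    rewrite <- (tech_pow_Rmult (1 - x)); field; split; lra. }
apply Rmult_le_compat.
- apply Rmult_le_pos; [lra|left; apply Rinv_0_lt_compat; lra].
- apply pow_le; exact HB0.
(* r / (r - |z|) <= 1 / (1 - x), which accounts for the last factor of (1 - x)^(2 n + 2). *)
- apply Rmult_le_reg_r with (r - Cmod z); [lra|].
  replace (r / (r - Cmod z) * (r - Cmod z)) with r by (field; lra).
  apply Rmult_le_reg_l with (1 - x); [lra|].
  replace ((1 - x) * (/ (1 - x) * (r - Cmod z))) with (r - Cmod z) by (field; lra); lra.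
(* One of the 2 n + 1 factors 1 - eps / 2 is dropped. *)
- unfold B; rewrite Rpow_mult_distr; apply Rmult_le_compat_r; [apply pow_le; lra|].
  rewrite pow_add, pow_1; rewrite <- (Rmult_1_r ((1 - eps / 2) ^ (2 * n))) at 2.
  apply Rmult_le_compat_l; [apply pow_le; lra|lra].
Qed.
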